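(* There exist absolute constants $C_1,\theta>0$ (in particular independent of $A,\gamma,\delta$) such that the following holds. Let $A\ge 1$, $\gamma>1$, $\delta\ge 1$, let $x_1,x_2\in\mathbb V$, and let $f_1,f_2:\mathbb R_+\to\mathbb R_+$ satisfy $$\mathbb P_{x_i}(X_t=x_i)\le \frac1{f_i(t)}\qquad\text{for all } t\ge 0,\ i=1,2.$$ If each $f_i$ is $(A,\gamma)$-regular and satisfies $f_i(t)\le A e^{\delta t}$ for all $t\in\mathbb R_+$, then $$\mathbb P_{x_1}(X_t=x_2)\le \frac{C_1A^{\beta}(\nu_{x_2}/\nu_{x_1})^{1/2}}{\sqrt{f_1(\alpha t)f_2(\alpha t)}}\exp\left(-\theta\,\frac{d_\nu(x_1,x_2)^2}{t}\right)\qquad\text{for all } t>0 \text{ with } t\ge d_\nu(x_1,x_2),$$ where $\alpha=\min\{(2\gamma)^{-1},(64\delta)^{-1}\}$ and $\beta=\left\lceil\frac{\log 2}{\log\gamma}\right\rceil$.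
   Context: $\mathbb R_+=[0,\infty)$. $\Gamma=(\mathbb V,\mathbb E)$ is a connected, locally finite graph (finite or infinite) without double edges; $x\sim y$ means $(x,y)\in\mathbb E$. $\mu$ is an edge weight: $\mu_{xy}=\mu_{yx}>0$ if $(x,y)\in\mathbb E$ and $\mu_{xy}=0$ otherwise. $\nu_x>0$ is given for each $x\in\mathbb V$. $X=(X_t)_{t\ge0}$ is the (minimal, i.e. killed at explosion) continuous time random walk on $\mathbb V$ with generator $\mathscr L f(x)=\frac1{\nu_x}\sum_{y\in\mathbb V}(f(y)-f(x))\mu_{xy}$, and $\mathbb P_x$ is its law when started from $x$. $d_\nu$ is a metric on $\mathbb V$ such that $\frac1{\nu_x}\sum_y d_\nu(x,y)^2\mu_{xy}\le 1$ for all $x\in\mathbb V$, and $d_\nu(x,y)\le 1$ whenever $x\sim y$. A function $f:\mathbb R_+\to\mathbb R_+$ is $(A,\gamma)$-regular if it is non-decreasing on $\mathbb R_+$ and $\frac{f(\gamma s)}{f(s)}\le A\frac{f(\gamma t)}{f(t)}$ for all $0\le s<t<\infty$. Conventions: $f$ is positive on $(0,\infty)$; $1/0=+\infty$; if $f(0)=0$, the inequality with $s=0$ is read in cross-multiplied form $f(\gamma s)f(t)\le A f(\gamma t)f(s)$. *)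

(* Defs.v *)
From HB Require Import structures.
From mathcomp Require Import all_boot all_order all_algebra.
From mathcomp Require Import all_classical all_reals all_analysis.
From mathcomp Require Import measurable_realfun.

Set Implicit Arguments.
Unset Strict Implicit.
Unset Printing Implicit Defensive.

Import Order.TTheory GRing.Theory Num.Theory.
Import numFieldNormedType.Exports.

Local Open Scope classical_set_scope.
Local Open Scope ring_scope.

(* An edge relation excludes double edges; loops are not excluded, and the
   graph may be finite or infinite. *)
Definition connected_locally_finite_graph (V : eqType) (E : rel V) : Prop :=
  [/\ symmetric E,
      forall x y, exists2 p : seq V, path E x p & last x p = y
    & forall x, finite_set [set y | E x y]].

Definition edge_weight (R : realType) (V : Type) (E : rel V)
    (mu : V -> V -> R) : Prop :=
  [/\ forall x y, mu x y = mu y x,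
      forall x y, E x y -> 0 < mu x y
    & forall x y, ~~ E x y -> mu x y = 0].

(* The sum has finite support as soon as E is locally finite and mu is an edge
   weight on E. *)
Definition generator (R : realType) (V : choiceType) (mu : V -> V -> R)
    (nu : V -> R) (f : V -> R) (x : V) : R :=
  (nu x)^-1 * \sum_(y \in [set: V]) (f y - f x) * mu x y.

Definition adapted_metric (R : realType) (V : metricType R) (E : rel V)
    (mu : V -> V -> R) (nu : V -> R) : Prop :=
  (forall x, (nu x)^-1 * \sum_(y \in [set: V]) mdist x y ^+ 2 * mu x y <= 1) /\
  (forall x y, E x y -> mdist x y <= 1).

(* Entries of the Q-matrix of an operator L: L f x = \sum_y qmatrix L x y * f y. *)
Definition qmatrix (R : realType) (V : eqType) (L : (V -> R) -> V -> R)
    (x y : V) : R :=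
  L (fun z => (z == y)%:R) x.

(* A state x with qmatrix L x x = 0 is absorbing; for the generator above this
   happens only if the graph has a single vertex. *)
Definition jump_prob (R : realType) (V : eqType) (L : (V -> R) -> V -> R)
    (x y : V) : R :=
  if qmatrix L x x == 0 then (x == y)%:R
  else if x == y then 0 else qmatrix L x y / - qmatrix L x x.

Definition jump_time (R : realType) (Omega : Type)
    (S : nat -> Omega -> \bar R) (n : nat) (w : Omega) : \bar R :=
  (\sum_(i < n) S i w)%E.

(* X is the minimal right-continuous Markov chain with generator L, and P x is
   its law when started from x: X is built from a jump chain Y and holding times
   S where, under P x, Y is the Markov chain started from x with transition
   probabilities jump_prob L and, given Y, the S i are independent, S i being
   exponential with rate - qmatrix L (Y i) (Y i).  The joint law is given on
   the generating pi-system of events {Y i = v i and S i > s i for i <= n}.  A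
   holding time is +oo almost surely in an absorbing state.  None is the
   cemetery, where X is sent once t >= sup_n jump_time S n (explosion). *)
Definition minimal_ctmc (R : realType) (V : eqType) (L : (V -> R) -> V -> R)
    (d : measure_display) (Omega : measurableType d) (P : V -> probability Omega R)
    (X : R -> Omega -> option V) : Prop :=
  exists (Y : nat -> Omega -> V) (S : nat -> Omega -> \bar R),
  [/\ (forall n v, measurable [set w | Y n w = v]) /\
        (forall n, measurable_fun [set: Omega] (S n)),
      forall n w, (0 < S n w)%E,
      forall x n (v : nat -> V) (s : nat -> R), (forall i, 0 <= s i) ->
        P x [set w | forall i, (i <= n)%N ->
               Y i w = v i /\ ((s i)%:E < S i w)%E] =
        ((v 0%N == x)%:R * (\prod_(i < n) jump_prob L (v i) (v i.+1))
          * \prod_(i < n.+1) expR (qmatrix L (v i) (v i) * s i))%:E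
    & forall t w y, 0 <= t ->
        X t w = Some y <->
        exists n, Y n w = y /\
          (jump_time S n w <= t%:E < jump_time S n.+1 w)%E].

(* Only the values of f on [0, +oo) matter.  If f 0 = 0 and s = 0 then, division
   by zero being zero, the last clause reads 0 <= A * (f (gamma * t) / f t); like
   the cross-multiplied inequality f 0 * f t <= A * f (gamma * t) * f 0, it is
   vacuous. *)
Definition regular_fun (R : realType) (A gamma : R) (f : R -> R) : Prop :=
  [/\ forall t, 0 <= t -> 0 <= f t,
      forall t, 0 < t -> 0 < f t,
      forall s t, 0 <= s -> s <= t -> f s <= f t
    & forall s t, 0 <= s -> s < t ->
        f (gamma * s) / f s <= A * (f (gamma * t) / f t)].

(* Main.v *)
Require Import Defs.
From HB Require Import structures.
From mathcomp Require Import all_boot all_order all_algebra.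
From mathcomp Require Import all_classical all_reals all_analysis.
From mathcomp Require Import measurable_realfun.
From mathcomp Require Import ring lra.

Set Implicit Arguments.
Unset Strict Implicit.
Unset Printing Implicit Defensive.

Import Order.TTheory GRing.Theory Num.Theory.
Import numFieldNormedType.Exports.

Local Open Scope classical_set_scope.
Local Open Scope ring_scope.

(** The proof combines Davies' weighted energy method with Grigor'yan's iteration, for
    truncations of the heat kernel that involve finite sums only.

    Let u t x y be the probability that the walk started from x is at y at time t after less
    than N jumps, the earlier states lying in a finite set F. The transition probability of
    X is the supremum of these quantities over N and F ([trunc_path_kernel_le],
    [at_state_le]). The description of X by a jump chain and exponential holding times
    yields, path by path, the forward equation of the kernel graded by the number of jumps
    ([occupation_forward], [path_kernel_graded]).
    Uniqueness of solutions then gives the Chapman-Kolmogorov identity, the backward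
    equation and the symmetry nu x u t x y = nu y u t y x ([graded_chapman_kolmogorov],
    [graded_symmetry]).

    For fixed x, the function u / nu is a subsolution of the heat equation. Its energy with
    weight expR (2 psi), where psi has slope l <= 1/2 for the adapted metric, grows at most
    at rate 4 l^2 ([energy_twisted_le], [twisted_rate_lipschitz]); choosing psi linear inside
    a ball compares the energy outside a ball at time t with the energy outside a smaller
    ball at an earlier time s plus a small multiple of the total energy at time s
    ([far_energy_step]). The total energy at time s is at most the return probability at
    time 2 s divided by nu x, hence at most 1 / (nu x f (2 s)) ([total_energy_le]).

    This comparison is iterated along geometrically decreasing times ([energy_iteration]).
    Regularity of f controls how much 1 / f grows along these times. As the space is
    discrete, the iteration must stop at times of the order of the radius, where the energy
    starting from a point mass is directly bounded by a negative exponential of the radius;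
    there the bound f t <= A expR (delta t) is used ([far_energy_gaussian]). Up to a
    constant, the outcome is A^b / (nu x f (alpha t)) times a Gaussian factor, where b is the
    least number of multiplications by gamma that achieve a doubling. Finally, the
    Chapman-Kolmogorov identity at time t / 2 and the Cauchy-Schwarz inequality, applied
    separately to the points far from x1 and to those far from x2, give the off-diagonal
    bound ([off_diagonal_le]). *)

(** * Functions with a right derivative up to a quadratic error *)

Section UniformRightDerivative.
Variable R : realType.
Implicit Types (g b : R -> R) (e : R -> R -> R) (c s t h T : R).

(** The error bound is uniform on bounded intervals and only looks to the right of
    nonnegative times, so that it can be checked directly on probabilities indexed by
    [0, +oo[. Uniformity makes comparison arguments elementary: increments are summed
    along a subdivision, without any appeal to continuity. *)
Definition qderiv g b :=
  forall T, exists C, forall t h, 0 <= t -> 0 <= h -> t + h <= T ->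
    `|g (t + h) - g t - h * b t| <= C * h ^+ 2.

Lemma qderiv_nnegC g b : qderiv g b ->
  forall T, exists2 C, 0 <= C & forall t h, 0 <= t -> 0 <= h -> t + h <= T ->
    `|g (t + h) - g t - h * b t| <= C * h ^+ 2.
Proof.
move=> gb T; have [C HC] := gb T; exists `|C| => // t h t0 h0 thT.
by apply: le_trans (HC _ _ t0 h0 thT) _; rewrite ler_wpM2r ?sqr_ge0 ?ler_norm.
Qed.

(** Boundedness of b comes from that of g by taking h = 1; the product rule below
    therefore needs no assumption on b. *)
Lemma qderiv_bounded g b : qderiv g b ->
  forall T, exists2 M, 0 <= M &
    forall t, 0 <= t -> t <= T -> `|g t| <= M /\ `|b t| <= M.
Proof.
move=> gb.
have bg T : exists2 M, 0 <= M & forall t, 0 <= t -> t <= T -> `|g t| <= M.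
  have [C C0 HC] := qderiv_nnegC gb T.
  exists (`|g 0| + `|T| * `|b 0| + C * T ^+ 2) => [|t t0 tT].
    by rewrite !addr_ge0 // mulr_ge0 ?sqr_ge0 //.
  have H := HC 0 t (lexx _) t0; rewrite add0r in H; have {}H := H tT.
  have -> : g t = g 0 + t * b 0 + (g t - g 0 - t * b 0) by ring.
  apply: le_trans (ler_normD _ _) _; apply: lerD.
    apply: le_trans (ler_normD _ _) _; rewrite lerD2l normrM ler_wpM2r //.
    by rewrite ger0_norm // (le_trans tT) ?ler_norm.
  apply: le_trans H _; rewrite ler_wpM2l // ler_sqr ?nnegrE //.
  exact: le_trans t0 tT.
move=> T; have [M M0 HM] := bg (T + 1).
have [C C0 HC] := qderiv_nnegC gb (T + 1).
exists (M + M + C) => [|t t0 tT]; first by rewrite !addr_ge0.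
have tM : `|g t| <= M by apply: HM; lra.
have t1M : `|g (t + 1)| <= M by apply: HM; lra.
split; first lra.
have := HC t 1 t0 ler01; rewrite lerD2r => /(_ tT); rewrite mul1r expr1n mulr1 => H.
have -> : b t = g (t + 1) - g t - (g (t + 1) - g t - b t) by ring.
apply: le_trans (ler_normB _ _) _; apply: lerD => //.
by apply: le_trans (ler_normB _ _) _; apply: lerD.
Qed.

Lemma qderiv_ext g b g' b' : (forall t, 0 <= t -> g t = g' t) ->
  (forall t, 0 <= t -> b t = b' t) -> qderiv g b -> qderiv g' b'.
Proof.
move=> gg' bb' gb T; have [C HC] := gb T; exists C => t h t0 h0 thT.
by rewrite -!gg' -?bb' ?addr_ge0 //; exact: HC.
Qed.

Lemma qderiv_cst c : qderiv (fun=> c) (fun=> 0).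
Proof. by move=> T; exists 0 => t h *; rewrite subrr mulr0 subr0 normr0 mul0r. Qed.

Lemma qderivD g1 b1 g2 b2 : qderiv g1 b1 -> qderiv g2 b2 ->
  qderiv (fun t => g1 t + g2 t) (fun t => b1 t + b2 t).
Proof.
move=> gb1 gb2 T; have [C1 H1] := gb1 T; have [C2 H2] := gb2 T.
exists (C1 + C2) => t h t0 h0 thT.
have -> : g1 (t + h) + g2 (t + h) - (g1 t + g2 t) - h * (b1 t + b2 t) =
  (g1 (t + h) - g1 t - h * b1 t) + (g2 (t + h) - g2 t - h * b2 t) by ring.
by rewrite mulrDl; apply: le_trans (ler_normD _ _) _; apply: lerD; auto.
Qed.

Lemma qderiv_sum (I : Type) (r : seq I) (g b : I -> R -> R) :
  (forall i, qderiv (g i) (b i)) ->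
  qderiv (fun t => \sum_(i <- r) g i t) (fun t => \sum_(i <- r) b i t).
Proof.
move=> gb; elim: r => [|i r IHr].
  by apply: qderiv_ext (qderiv_cst 0) => t _; rewrite big_nil.
by apply: qderiv_ext (qderivD (gb i) IHr) => t _; rewrite big_cons.
Qed.

Lemma qderivM g1 b1 g2 b2 : qderiv g1 b1 -> qderiv g2 b2 ->
  qderiv (fun t => g1 t * g2 t) (fun t => b1 t * g2 t + g1 t * b2 t).
Proof.
move=> gb1 gb2 T.
have [C1 C10 H1] := qderiv_nnegC gb1 T; have [C2 C20 H2] := qderiv_nnegC gb2 T.
have [M1 M10 B1] := qderiv_bounded gb1 T; have [M2 M20 B2] := qderiv_bounded gb2 T.
exists (C1 * M2 + (M1 + `|T| * M1) * C2 + M1 * M2) => t h t0 h0 thT.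
have tT : t <= T by lra.
have hT : h <= `|T| by apply: le_trans (ler_norm _); lra.
have [G1 D1] := B1 _ t0 tT; have [G2 D2] := B2 _ t0 tT.
have [G2' _] := B2 _ (addr_ge0 t0 h0) thT.
have {}H1 := H1 _ _ t0 h0 thT; have {}H2 := H2 _ _ t0 h0 thT.
set e1 := g1 (t + h) - _ - _ in H1; set e2 := g2 (t + h) - _ - _ in H2.
have -> : g1 (t + h) * g2 (t + h) - g1 t * g2 t - h * (b1 t * g2 t + g1 t * b2 t)
  = e1 * g2 (t + h) + (g1 t + h * b1 t) * e2 + b1 t * b2 t * h ^+ 2.
  by rewrite /e1 /e2; ring.
rewrite [leRHS]mulrDl [X in _ <= X + _]mulrDl.
apply: le_trans (ler_normD _ _) _; apply: lerD; last first.
  by rewrite normrM normrX (ger0_norm h0) normrM ler_wpM2r ?sqr_ge0 // ler_pM.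
apply: le_trans (ler_normD _ _) _; apply: lerD.
  by rewrite normrM mulrAC ler_pM.
rewrite normrM -mulrA ler_pM // (le_trans (ler_normD _ _)) // lerD //.
by rewrite normrM ler_pM // ger0_norm.
Qed.

Lemma qderivZ c g b : qderiv g b -> qderiv (fun t => c * g t) (fun t => c * b t).
Proof.
by move/(qderivM (qderiv_cst c)); apply: qderiv_ext => t _ //; rewrite mul0r add0r.
Qed.

Lemma qderiv_shift g b s : 0 <= s -> qderiv g b ->
  qderiv (fun t => g (s + t)) (fun t => b (s + t)).
Proof.
move=> s0 gb T; have [C HC] := gb (s + T); exists C => t h t0 h0 thT.
by rewrite addrA; apply: HC; rewrite ?addr_ge0 // -addrA lerD2l.
Qed.

Lemma expR_sub1_sub_le (x : R) : 0 <= expR x - 1 - x <= expR `|x| * x ^+ 2.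
Proof.
have H1 := expR_ge1Dx x; have H2 := expR_ge1Dx (- x).
have e0 := expR_gt0 x.
have H3 : (1 - x) * expR x <= 1.
  by rewrite -[leRHS](expRxMexpNx_1 x) mulrC ler_pM2l //; exact: H2.
apply/andP; split; first lra.
have H4 : expR x - 1 - x <= x * (expR x - 1) by lra.
apply: le_trans H4 _; have [x0|x0] := leP 0 x.
  by rewrite ger0_norm // expr2 [leRHS]mulrCA ler_wpM2l //; lra.
have -> : x * (expR x - 1) = - x * (1 - expR x) by ring.
have -> : x ^+ 2 = - x * - x by ring.
rewrite ltr0_norm //.
have e1 : 1 <= expR (- x) by lra.
apply: (@le_trans _ _ (- x * - x)); first by rewrite ler_wpM2l //; lra.
by rewrite ler_peMl // mulr_ge0 //; lra.
Qed.

Lemma qderiv_expR c : qderiv (fun t => expR (c * t)) (fun t => c * expR (c * t)).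
Proof.
move=> T; exists (expR (`|c| * `|T|) * (expR (`|c| * `|T|) * c ^+ 2)) => t h t0 h0 thT.
have -> : expR (c * (t + h)) - expR (c * t) - h * (c * expR (c * t)) =
  expR (c * t) * (expR (c * h) - 1 - c * h).
  by rewrite mulrDr expRD; ring.
have eT s : 0 <= s -> s <= T -> expR `|c * s| <= expR (`|c| * `|T|).
  move=> s0 sT; rewrite ler_expR normrM ler_wpM2l //.
  by rewrite ger0_norm // (le_trans sT) ?ler_norm.
have /andP[x0 xle] := expR_sub1_sub_le (c * h).
rewrite normrM ger0_norm ?expR_ge0 // ger0_norm // -mulrA ler_pM ?expR_ge0 //.
  by apply: le_trans (eT t t0 _); rewrite ?ler_expR ?ler_norm //; lra.
apply: le_trans xle _; rewrite -mulrA -exprMn ler_wpM2r ?sqr_ge0 //.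
by apply: eT => //; lra.
Qed.

(** Over n steps of length (t - s) / n the quadratic errors add up to C (t - s)^2 / n. *)
Lemma qderiv_le g b s t : qderiv g b -> (forall u, 0 <= u -> b u <= 0) ->
  0 <= s -> s <= t -> g t <= g s.
Proof.
move=> gb b0 s0 st; have [C C0 HC] := qderiv_nnegC gb t.
apply/ler_addgt0Pr => e e0.
pose D := C * (t - s) ^+ 2.
have D0 : 0 <= D by rewrite mulr_ge0 ?sqr_ge0 //.
have nD := truncnS_gt (D / e); set n := Num.truncn _ in nD.
have [h hE] : exists h, h = (t - s) / n.+1%:R by exists ((t - s) / n.+1%:R).
have h0 : 0 <= h by rewrite hE divr_ge0 ?subr_ge0.
have hn : h * n.+1%:R = t - s by rewrite hE divfK // pnatr_eq0.
(* Each step of length h costs at most C h^2. *)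
have step i : (i <= n.+1)%N -> g (s + h * i%:R) <= g s + i%:R * (C * h ^+ 2).
  elim: i => [_|i IHi ilen]; first by rewrite mulr0 mul0r !addr0.
  have {}IHi := IHi (ltnW ilen).
  have ih0 : 0 <= s + h * i%:R by rewrite addr_ge0 // mulr_ge0.
  have := HC _ h ih0 h0.
  have e1 : s + h * i%:R + h = s + h * i.+1%:R by rewrite -[i.+1%:R]natr1 mulrDr mulr1 addrA.
  rewrite e1.
  have -> // : s + h * i.+1%:R <= t.
    by rewrite -lerBrDl -hn ler_wpM2l // ler_nat.
  move=> /(_ isT) /ler_normlP[_ H].
  have hb : h * b (s + h * i%:R) <= 0 by rewrite mulr_ge0_le0 // b0.
  by rewrite -[X in _ <= _ + X * _]natr1 mulrDl mul1r; lra.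
have := step n.+1 (leqnn _); rewrite hn subrKC => /le_trans; apply.
rewrite lerD2l.
have -> : n.+1%:R * (C * h ^+ 2) = D / n.+1%:R.
  by rewrite expr2 !mulrA [n.+1%:R * C]mulrC -[C * _ * h]mulrA [n.+1%:R * h]mulrC hn
     {1}hE mulrA -[C * _ * _]mulrA -expr2.
by rewrite ltW // ltr_pdivrMr // mulrC -ltr_pdivrMr.
Qed.

(** The function expR (- c t) g t is nonincreasing. *)
Lemma qderiv_gronwall c g b s t : qderiv g b -> (forall u, 0 <= u -> b u <= c * g u) ->
  0 <= s -> s <= t -> g t <= expR (c * (t - s)) * g s.
Proof.
move=> gb bcg s0 st.
have H := @qderiv_le _ _ s t (qderivM (qderiv_expR (- c)) gb) _ s0 st.
have {H} : expR (- c * t) * g t <= expR (- c * s) * g s.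
  apply: H => u u0; have := bcg u u0.
  rewrite -(ler_pM2l (expR_gt0 (- c * u))); lra.
rewrite -(ler_pM2l (expR_gt0 (c * t))) mulrA -expRD mulrA -expRD.
have -> : c * t + - c * t = 0 by ring.
by rewrite expR0 mul1r; have -> : c * t + - c * s = c * (t - s) by ring.
Qed.

(** Uniqueness for the equation g' = c g: the previous lemma applies to g and to - g. *)
Lemma qderiv_eq0 c g b t : qderiv g b -> (forall u, 0 <= u -> b u = c * g u) ->
  g 0 = 0 -> 0 <= t -> g t = 0.
Proof.
move=> gb bcg g0 t0; apply/eqP; rewrite eq_le; apply/andP; split.
  have := @qderiv_gronwall c g b 0 t gb _ (lexx _) t0; rewrite g0 mulr0; apply.
  by move=> u /bcg ->.
have := @qderiv_gronwall c _ _ 0 t (qderivZ (-1) gb) _ (lexx _) t0.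
rewrite g0 !mulr0 mulN1r oppr_le0; apply => u /bcg ->.
by rewrite mulrCA.
Qed.

(** The remainder of [qderiv] taken by itself: it is needed when a derivative is computed
    through a convolution identity and not term by term. *)
Definition quadratic e := forall T, exists C, forall t h,
  0 <= t -> 0 <= h -> t + h <= T -> `|e t h| <= C * h ^+ 2.

Lemma quadratic_sum (I : Type) (r : seq I) (e : I -> R -> R -> R) :
  (forall i, quadratic (e i)) -> quadratic (fun t h => \sum_(i <- r) e i t h).
Proof.
move=> He T; elim: r => [|i r [C IHr]].
  by exists 0 => t h *; rewrite big_nil normr0 mul0r.
have [D HD] := He i T; exists (D + C) => t h t0 h0 thT; rewrite big_cons mulrDl.
by apply: le_trans (ler_normD _ _) _; apply: lerD; auto.
Qed.

(** An expansion of g at time 0 is transported to time t by the factor k t. This is how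
    a forward equation at time 0 turns into a backward equation at time t. *)
Lemma quadratic_initM g b k bk : qderiv g b -> qderiv k bk ->
  quadratic (fun t h => (g h - g 0 - h * b 0) * k t).
Proof.
move=> gb kb T; have [C C0 HC] := qderiv_nnegC gb T.
have [M M0 HM] := qderiv_bounded kb T; exists (C * M) => t h t0 h0 thT.
rewrite normrM mulrAC ler_pM //; last by apply: (HM _ t0 _).1; lra.
by have := HC 0 h (lexx _) h0; rewrite add0r; apply; lra.
Qed.

End UniformRightDerivative.

(** * Kernels graded by the number of jumps *)

Lemma sum_antidiagonal (R : nmodType) (c : nat -> nat -> R) (M : nat) :
  \sum_(n < M) \sum_(m < n.+1) c m (n - m)%N = \sum_(m < M) \sum_(k < M - m) c m k.
Proof.
elim: M => [|M IHM]; first by rewrite !big_ord0.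
rewrite big_ord_recr /= IHM [RHS]big_ord_recr /= big_ord_recr /= addrA -big_split /=.
congr (_ + _); last by rewrite subSnn big_ord1 subnn.
by apply: eq_bigr => m _; rewrite subSn ?big_ord_recr //= ltnW.
Qed.

Lemma sum_seq_eq (R : realType) (V : eqType) (F : seq V) (G : V -> R) y :
  uniq F -> y \in F -> \sum_(z <- F) G z * (z == y)%:R = G y.
Proof.
move=> F_uniq yF; rewrite (bigD1_seq y) //= eqxx mulr1 big1 ?addr0 // => z /negPf ->.
by rewrite mulr0.
Qed.

Section GradedKernel.
Variables (R : realType) (V : eqType) (F : seq V) (q : V -> R) (rate : V -> V -> R).
Implicit Types (a : nat -> R -> V -> V -> R) (x y z : V) (s t h : R) (n m N : nat).

(** Here [a n t x y] stands for the probability to go from x to y in time t in exactly n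
    jumps, the states visited before the last one lying in the finite list F; q is the
    rate of leaving a state and [rate z y] the rate of the jumps from z to y. The grading
    by n makes the forward equations triangular, so that they determine a by induction
    on n. *)
Record graded_kernel a : Prop := GradedKernel {
  gk_ge0 : forall n t x y, 0 <= t -> 0 <= a n t x y;
  gk_0 : forall t x y, 0 <= t -> a 0%N t x y = (x == y)%:R * expR (- q y * t);
  gk_S0 : forall n x y, a n.+1 0 x y = 0;
  gk_forward : forall n x y, qderiv (fun t => a n.+1 t x y)
    (fun t => - q y * a n.+1 t x y + \sum_(z <- F) a n t x z * rate z y) }.

Variable a : nat -> R -> V -> V -> R.
Hypotheses (F_uniq : uniq F) (ka : graded_kernel a).

Definition inflow n t x y : R :=
  if n is m.+1 then \sum_(z <- F) a m t x z * rate z y else 0.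

Lemma gk_init n x y : a n 0 x y = ((n == 0%N) && (x == y))%:R.
Proof.
by case: n => [|n]; rewrite ?(gk_0 ka) ?(gk_S0 ka) // mulr0 expR0 mulr1.
Qed.

Lemma gk_deriv n x y : qderiv (fun t => a n t x y)
  (fun t => - q y * a n t x y + inflow n t x y).
Proof.
case: n => [|n] /=; last exact: (gk_forward ka).
apply: qderiv_ext (qderivZ (x == y)%:R (qderiv_expR (- q y))) => t t0;
  by rewrite (gk_0 ka) // ?addr0 // mulrCA.
Qed.

(** As functions of t both sides solve the same forward equation and agree at t = 0; the
    inflow terms agree by induction on n. *)
Lemma graded_chapman_kolmogorov n s t x y : 0 <= s -> 0 <= t -> y \in F ->
  a n (s + t) x y = \sum_(m < n.+1) \sum_(z <- F) a m s x z * a (n - m)%N t z y.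
Proof.
move=> s0; elim: n y t => [|n IHn] y t t0 yF; apply/eqP; rewrite -subr_eq0; apply/eqP.
  have := qderivD (qderiv_shift s0 (gk_deriv 0 x y)) (qderivZ (-1) (qderiv_sum F
    (fun z => qderivZ (a 0%N s x z) (gk_deriv 0 z y)))).
  move=> /(@qderiv_eq0 _ (- q y) _ _ t) /(_ _ _ t0).
  move=> H; rewrite big_ord1 -mulN1r; apply: H => [u u0|].
    rewrite /= !addr0 mulN1r mulrDr; congr (_ + _); rewrite !mulN1r mulrN mulr_sumr.
    by congr (- _); apply: eq_bigr => z _; rewrite addr0 mulrCA.
  rewrite addr0 -[X in X + _](sum_seq_eq (a 0%N s x) F_uniq yF) mulN1r; apply/eqP.
  by rewrite subr_eq0; apply/eqP; apply: eq_bigr => z _; rewrite gk_init.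
have dsum : forall m : 'I_n.+2, qderiv
    (fun t => \sum_(z <- F) a m s x z * a (n.+1 - m)%N t z y)
    (fun t => \sum_(z <- F) a m s x z *
       (- q y * a (n.+1 - m)%N t z y + inflow (n.+1 - m) t z y)).
  by move=> m; apply: qderiv_sum => z; apply: qderivZ; exact: gk_deriv.
have := qderivD (qderiv_shift s0 (gk_deriv n.+1 x y))
  (qderivZ (-1) (qderiv_sum (index_enum _) dsum)).
move=> /(@qderiv_eq0 _ (- q y) _ _ t) /(_ _ _ t0).
move=> H; rewrite -mulN1r; apply: H => [u u0|].
  rewrite [inflow n.+1 _ _ _]/= mulrDr -addrA; congr (_ + _).
  rewrite !mulN1r !mulrN mulr_sumr.
  have -> : \sum_(z <- F) a n (s + u) x z * rate z y =
     \sum_(m < n.+2) \sum_(z <- F) a m s x z * inflow (n.+1 - m) u z y.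
    rewrite big_ord_recr /= subnn /= [X in _ = _ + X]big1 ?addr0; last first.
      by move=> z _; rewrite mulr0.
    under eq_big_seq => z zF do rewrite IHn // mulr_suml.
    rewrite exchange_big; apply: eq_bigr => m _ /=.
    under eq_bigr do rewrite mulr_suml.
    rewrite exchange_big; apply: eq_bigr => z _ /=.
    rewrite subSn /= ?mulr_sumr; last by rewrite -ltnS.
    by apply: eq_bigr => w _; rewrite mulrA.
  rewrite -sumrB -sumrN; apply: eq_bigr => m _.
  by rewrite mulr_sumr -sumrB -sumrN; apply: eq_bigr => z _; ring.
rewrite addr0 mulN1r; apply/eqP.
rewrite subr_eq0 -[X in X == _](sum_seq_eq (a n.+1 s x) F_uniq yF).
rewrite big_ord_recr /= subnn [X in _ == X + _]big1 ?add0r; last first.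
  move=> m _; rewrite big1 // => z _; rewrite gk_init subn_eq0 leqNgt.
  by rewrite ltnS -ltnS ltn_ord /= mulr0.
by apply/eqP; apply: eq_bigr => z _; rewrite gk_init.
Qed.

Lemma inflow_init m x z : x \in F ->
  inflow m 0 x z = (m == 1%N)%:R * rate x z.
Proof.
move=> xF; case: m => [|m] /=; first by rewrite mul0r.
rewrite -(sum_seq_eq (fun w => (m.+1 == 1%N)%:R * rate w z) F_uniq xF).
apply: eq_bigr => w _; rewrite gk_init eqSS [w == x]eq_sym.
by case: (m == 0%N); rewrite ?mul0r ?mul1r ?mul0r // mulrC.
Qed.

(** Expand the Chapman-Kolmogorov identity for the times h and t at h = 0: to first order
    in h there is at most one jump before time h. *)
Lemma graded_backward n x y : x \in F -> y \in F ->
  qderiv (fun t => a n.+1 t x y)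
    (fun t => - q x * a n.+1 t x y + \sum_(z <- F) rate x z * a n t z y).
Proof.
move=> xF yF.
(* The remainder of the backward equation is the sum of the remainders, at time 0, of the
   forward expansions of the first factors. *)
pose e (m : 'I_n.+2) t h := \sum_(z <- F) (a m h x z - a m 0 x z -
  h * (- q z * a m 0 x z + inflow m 0 x z)) * a (n.+1 - m)%N t z y.
have qe (m : 'I_n.+2) : quadratic (e m).
  apply: quadratic_sum => z.
  exact: quadratic_initM (gk_deriv m x z) (gk_deriv (n.+1 - m) z y).
move=> T; have [C HC] := quadratic_sum (index_enum 'I_n.+2) qe T.
exists C => t h t0 h0 thT; apply: le_trans (HC t h t0 h0 thT).
suff -> : a n.+1 (t + h) x y - a n.+1 t x y - h * (- q x * a n.+1 t x y +
  \sum_(z <- F) rate x z * a n t z y) = \sum_(m < n.+2) e m t h by [].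
have CK u : 0 <= u -> a n.+1 (u + t) x y =
    \sum_(m < n.+2) \sum_(z <- F) a m u x z * a (n.+1 - m)%N t z y.
  move=> u0; exact: (graded_chapman_kolmogorov n.+1 x u0 t0 yF).
have init (c : V -> R) : \sum_(m < n.+2) \sum_(z <- F) c z * a m 0 x z *
    a (n.+1 - m)%N t z y = c x * a n.+1 t x y.
  rewrite big_ord_recl /= subn0 [X in _ + X]big1 ?addr0; last first.
    by move=> m _; rewrite big1 // => z _; rewrite gk_init mulr0 mul0r.
  rewrite -(sum_seq_eq (fun z => c z * a n.+1 t z y) F_uniq xF).
  by apply: eq_bigr => z _; rewrite gk_init eqxx /= [x == z]eq_sym mulrAC.
have first : \sum_(m < n.+2) \sum_(z <- F) inflow m 0 x z *
    a (n.+1 - m)%N t z y = \sum_(z <- F) rate x z * a n t z y.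
  under eq_bigr do under eq_bigr do rewrite inflow_init //.
  rewrite big_ord_recl big1 ?add0r => [|z _]; last by rewrite !mul0r.
  rewrite big_ord_recl [X in _ + X]big1 ?addr0 => [|m _]; last first.
    by rewrite big1 // => z _; rewrite !mul0r.
  by apply: eq_bigr => z _; rewrite mul1r subSS subn0.
rewrite [t + h]addrC CK // -[X in _ - X - _]mul1r.
rewrite -[1 * _](init (fun=> 1)) -[- q x * _](init (fun z => - q z)).
rewrite -first -big_split /= mulr_sumr -!sumrB; apply: eq_bigr => m _.
rewrite -big_split /= mulr_sumr -!sumrB; apply: eq_bigr => z _.
by rewrite mul1r; ring.
Qed.

Variable nu : V -> R.
Hypothesis rate_sym : forall x y, nu x * rate x y = nu y * rate y x.

(** Reversibility. By the backward equation, the right-hand side solves the forward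
    equation of the left-hand side. *)
Lemma graded_symmetry n t x y : 0 <= t -> x \in F -> y \in F ->
  nu x * a n t x y = nu y * a n t y x.
Proof.
elim: n x y t => [|n IHn] x y t t0 xF yF.
  by rewrite !(gk_0 ka) // [y == x]eq_sym; case: eqVneq => [->//|_]; rewrite !mul0r !mulr0.
apply/eqP; rewrite -subr_eq0; apply/eqP.
have := qderivD (qderivZ (nu x) (gk_forward ka n x y))
  (qderivZ (- nu y) (graded_backward n yF xF)).
move=> /(@qderiv_eq0 _ (- q y) _ _ t) /(_ _ _ t0) H.
rewrite -mulNr; apply: H => [u u0|]; last by rewrite !(gk_S0 ka) !mulr0 addr0.
suff E : nu x * \sum_(z <- F) a n u x z * rate z y =
    nu y * \sum_(z <- F) rate y z * a n u z x.
  by rewrite !mulrDr [- nu y * (\sum_(z <- F) _)]mulNr -E; ring.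
rewrite !mulr_sumr; apply: eq_big_seq => z zF.
by rewrite mulrA IHn // mulrAC rate_sym mulrA.
Qed.

(** Bounding the number of jumps keeps all sums finite, and still yields a subsolution of
    the heat equation, which is enough for upper bounds. *)
Definition trunc_kernel N t x y : R := \sum_(n < N) a n t x y.
Local Notation u := trunc_kernel.

Lemma trunc_kernel_ge0 N t x y : 0 <= t -> 0 <= u N t x y.
Proof. by move=> t0; apply: sumr_ge0 => n _; exact: (gk_ge0 ka). Qed.

Lemma trunc_kernel_init N x y : u N.+1 0 x y = (x == y)%:R.
Proof.
rewrite /trunc_kernel big_ord_recl /= big1 => [|m _]; last exact: (gk_S0 ka).
by rewrite addr0 gk_init.
Qed.

Lemma trunc_kernel_mulE N M s t x y :
  \sum_(z <- F) u N s x z * u M t z y =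
  \sum_(m < N) \sum_(k < M) \sum_(z <- F) a m s x z * a k t z y.
Proof.
under eq_bigr do rewrite mulr_suml.
rewrite exchange_big; apply: eq_bigr => m _ /=.
under eq_bigr do rewrite mulr_sumr.
by rewrite exchange_big.
Qed.

Lemma trunc_kernelD N s t x y : 0 <= s -> 0 <= t -> y \in F ->
  u N (s + t) x y =
  \sum_(m < N) \sum_(k < N - m) \sum_(z <- F) a m s x z * a k t z y.
Proof.
move=> s0 t0 yF; rewrite -(sum_antidiagonal
  (fun m k => \sum_(z <- F) a m s x z * a k t z y)).
by apply: eq_bigr => n _; apply: graded_chapman_kolmogorov.
Qed.

Lemma ler_sum_ord_widen M N (c : nat -> R) : (M <= N)%N -> (forall i, 0 <= c i) ->
  \sum_(i < M) c i <= \sum_(i < N) c i.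
Proof.
move=> MN c0; rewrite -!(big_mkord xpredT c) [leRHS](big_cat_nat (n := M)) //=.
by rewrite lerDl sumr_ge0.
Qed.

(** Less than N jumps over the whole time interval implies less than N jumps over each of
    its two parts, which in turn implies less than 2 N jumps over the whole. *)
Lemma trunc_kernelD_le N s t x y : 0 <= s -> 0 <= t -> y \in F ->
  u N (s + t) x y <= \sum_(z <- F) u N s x z * u N t z y.
Proof.
move=> s0 t0 yF; rewrite trunc_kernelD // trunc_kernel_mulE.
apply: ler_sum => m _; apply: (@ler_sum_ord_widen _ _
  (fun k => \sum_(z <- F) a m s x z * a k t z y)); first exact: leq_subr.
by move=> k; apply: sumr_ge0 => z _; rewrite mulr_ge0 // (gk_ge0 ka).
Qed.

Lemma trunc_kernelD_ge N s t x y : 0 <= s -> 0 <= t -> y \in F ->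
  \sum_(z <- F) u N s x z * u N t z y <= u (N + N) (s + t) x y.
Proof.
move=> s0 t0 yF; rewrite trunc_kernelD // trunc_kernel_mulE.
have c0 m k : 0 <= \sum_(z <- F) a m s x z * a k t z y.
  by apply: sumr_ge0 => z _; rewrite mulr_ge0 // (gk_ge0 ka).
apply: (@le_trans _ _ (\sum_(m < N) \sum_(k < N + N - m)
    \sum_(z <- F) a m s x z * a k t z y)).
  apply: ler_sum => m _; apply: (@ler_sum_ord_widen _ _
    (fun k => \sum_(z <- F) a m s x z * a k t z y)) => //.
  by rewrite -addnBA ?leq_addr // ltnW.
apply: (@ler_sum_ord_widen _ _ (fun m => \sum_(k < N + N - m)
    \sum_(z <- F) a m s x z * a k t z y)) => [|m]; first exact: leq_addr.
exact: sumr_ge0.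
Qed.

Lemma trunc_kernel_symmetry N t x y : 0 <= t -> x \in F -> y \in F ->
  nu x * u N t x y = nu y * u N t y x.
Proof.
move=> t0 xF yF; rewrite !mulr_sumr; apply: eq_bigr => n _.
exact: graded_symmetry.
Qed.

Hypotheses (rate_ge0 : forall x y, 0 <= rate x y) (nu_gt0 : forall x, 0 < nu x).

Definition energy N x (w : V -> R) t : R :=
  \sum_(y <- F) u N t x y ^+ 2 * w y / nu y.

Lemma trunc_kernel_deriv N x y : qderiv (fun t => u N t x y)
  (fun t => \sum_(n < N) (- q y * a n t x y + inflow n t x y)).
Proof. by apply: qderiv_sum => n; exact: gk_deriv. Qed.

(** The inflow comes from one jump less, hence from a smaller truncated kernel. *)
Lemma trunc_kernel_subsolution N x y t : 0 <= t ->
  \sum_(n < N) (- q y * a n t x y + inflow n t x y) <=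
  - q y * u N t x y + \sum_(z <- F) u N t x z * rate z y.
Proof.
move=> t0; rewrite big_split /= -mulr_sumr lerD2l.
case: N => [|N]; first by rewrite big_ord0 sumr_ge0 // => z _; rewrite /u big_ord0 mul0r.
rewrite big_ord_recl add0r /= exchange_big; apply: ler_sum => z _ /=.
rewrite -mulr_suml ler_wpM2r //.
apply: (@ler_sum_ord_widen _ _ (fun n => a n t x z)) => // n.
exact: (gk_ge0 ka).
Qed.

(** In the Dirichlet form of the kernel conjugated by expR psi, the product of the values at
    y and z carries the factor expR (psi y - psi z) + expR (psi z - psi y) in place of 2;
    kappa measures the resulting growth. *)
Definition twisted_rate (psi : V -> R) (kappa : R) :=
  forall y, y \in F ->
  \sum_(z <- F) rate y z * (expR (psi y - psi z) + expR (psi z - psi y)) <=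
  2 * q y + kappa.

(** Davies' method. With W = expR psi * u / nu, the derivative of the energy is at most
    the sum over y of - 2 q nu W^2 plus the double sum of
    2 nu rate W(y) W(z) expR (psi y - psi z). Symmetrising the double sum in y and z and
    using 2 W(y) W(z) <= W(y)^2 + W(z)^2 reduces the claim to the hypothesis at each y. *)
Lemma energy_twisted_le psi kappa N x s t : twisted_rate psi kappa ->
  0 <= s -> s <= t ->
  energy N x (fun y => expR (2 * psi y)) t <=
  expR (kappa * (t - s)) * energy N x (fun y => expR (2 * psi y)) s.
Proof.
move=> tw s0 st; set E := energy N x _.
have dE : qderiv E (fun t => \sum_(y <- F)
    2 * (\sum_(n < N) (- q y * a n t x y + inflow n t x y)) * u N t x y *
      (expR (2 * psi y) / nu y)).
  apply: qderiv_sum => y.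
  have := qderivZ (expR (2 * psi y) / nu y)
    (qderivM (trunc_kernel_deriv N x y) (trunc_kernel_deriv N x y)).
  by apply: qderiv_ext => r _; ring.
apply: qderiv_gronwall dE _ s0 st => r r0.
pose W y := u N r x y * expR (psi y) / nu y.
have EW : E r = \sum_(y <- F) nu y * W y ^+ 2.
  apply: eq_bigr => y _; rewrite /W expr_div_n exprMn -expRM_natl.
  by field; rewrite gt_eqF.
have e2 y : expR (2 * psi y) = expR (psi y) ^+ 2 by rewrite -expRM_natl.
have W0 y : 0 <= W y.
  apply: divr_ge0; last exact: ltW.
  by rewrite mulr_ge0 ?expR_ge0 // trunc_kernel_ge0.
pose G := \sum_(y <- F) \sum_(z <- F)
  2 * (nu z * rate z y) * (W y * W z) * expR (psi y - psi z).
have step1 : \sum_(y <- F)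
    2 * (\sum_(n < N) (- q y * a n r x y + inflow n r x y)) * u N r x y *
      (expR (2 * psi y) / nu y) <= - \sum_(y <- F) 2 * q y * (nu y * W y ^+ 2) + G.
  rewrite -sumrN -big_split /=; apply: ler_sum => y _.
  have H := trunc_kernel_subsolution N x y r0.
  apply: (@le_trans _ _ (2 * (- q y * u N r x y + \sum_(z <- F) u N r x z * rate z y)
     * u N r x y * (expR (2 * psi y) / nu y))).
    rewrite ler_wpM2r ?divr_ge0 ?expR_ge0 ?(ltW (nu_gt0 y)) // ler_wpM2r ?trunc_kernel_ge0 //.
    by rewrite ler_wpM2l.
  rewrite mulrDr [_ * u N r x y]mulrDl [leLHS]mulrDl lerD // le_eqVlt; apply/orP; left; apply/eqP.
    by rewrite /W e2; field; rewrite gt_eqF.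
  rewrite [2 * _]mulr_sumr mulr_suml mulr_suml; apply: eq_bigr => z _.
  rewrite /W e2 expRB; field; rewrite gt_eqF ?expR_gt0 //=.
  by rewrite !gt_eqF.
have step2 : G <= \sum_(y <- F) nu y * W y ^+ 2 *
    \sum_(z <- F) rate y z * (expR (psi y - psi z) + expR (psi z - psi y)).
  pose c y z := nu z * rate z y * (expR (psi y - psi z) + expR (psi z - psi y)).
  have csym y z : c y z = c z y by rewrite /c rate_sym [X in _ * X]addrC.
  have c0 y z : 0 <= c y z.
    by rewrite /c mulr_ge0 ?addr_ge0 ?expR_ge0 // mulr_ge0 // ltW.
  have GE : 2 * G = \sum_(y <- F) \sum_(z <- F) 2 * c y z * (W y * W z).
    rewrite mulrDl mul1r {2}/G exchange_big -big_split /=; apply: eq_bigr => y _.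
    rewrite -big_split /=; apply: eq_bigr => z _.
    by rewrite /c [nu y * rate y z]rate_sym; ring.
  rewrite -(ler_pM2l (@ltr0n R 2)) GE.
  apply: (@le_trans _ _ (\sum_(y <- F) \sum_(z <- F) c y z * (W y ^+ 2 + W z ^+ 2))).
    apply: ler_sum => y _; apply: ler_sum => z _.
    have -> : 2 * c y z * (W y * W z) = c y z * (2 * (W y * W z)) by ring.
    rewrite ler_wpM2l //.
    have : 0 <= (W y - W z) ^+ 2 by exact: sqr_ge0.
    by nra.
  under eq_bigr do under eq_bigr do rewrite mulrDr.
  under eq_bigr do rewrite big_split /=.
  rewrite big_split /= [X in _ + X <= _]exchange_big /= mulrDl mul1r.
  rewrite le_eqVlt; apply/orP; left; apply/eqP; congr (_ + _).
    apply: eq_bigr => y _; rewrite mulr_sumr; apply: eq_bigr => z _.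
    by rewrite /c rate_sym; ring.
  apply: eq_bigr => y _; rewrite mulr_sumr; apply: eq_bigr => z _.
  by rewrite csym /c rate_sym; ring.
apply: le_trans step1 _; rewrite addrC lerBlDr; apply: le_trans step2 _.
rewrite EW mulr_sumr -big_split /=; rewrite big_seq [leRHS]big_seq.
apply: ler_sum => y yF.
have := tw y yF => H.
have nW : 0 <= nu y * W y ^+ 2 by rewrite mulr_ge0 ?sqr_ge0 // (ltW (nu_gt0 _)).
rewrite -mulrDl [leLHS]mulrC; apply: (ler_wpM2r nW).
by rewrite addrC.
Qed.

End GradedKernel.

(** * Iteration of energy estimates *)

Section Iteration.
Variable R : realType.
Implicit Types (I : R -> R -> R) (J f : R -> R) (A M L r s t l tau : R).

Lemma geometric_tail_le (c q : R) n : 0 <= c -> 0 <= q -> (c + 1) * q <= c ->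
  \sum_(k < n) q ^+ k.+1 <= (c + 1) * q.
Proof.
move=> c0 q0 cq.
have E : (\sum_(k < n) q ^+ k.+1) * (1 - q) = q - q ^+ n.+1.
  elim: n => [|n IHn]; first by rewrite big_ord0 mul0r expr1 subrr.
  by rewrite big_ord_recr /= mulrDl IHn !exprS; ring.
have p0 : 0 <= q ^+ n.+1 by rewrite exprn_ge0.
have c1 : 0 < c + 1 by lra.
have h : 1 <= (c + 1) * (1 - q) by lra.
have q1 : 0 < 1 - q by rewrite -(pmulr_rgt0 _ c1); lra.
rewrite -(ler_pM2r q1) E; apply: (@le_trans _ _ q); first lra.
by rewrite mulrAC ler_peMl.
Qed.

Lemma natr_le_expn (b : R) k : 2 <= b -> k.+1%:R <= b ^+ k.
Proof.
move=> b2; elim: k => [|k IHk]; first by rewrite expr0.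
rewrite exprS; apply: (@le_trans _ _ (2 * b ^+ k)); last first.
  by rewrite ler_wpM2r // exprn_ge0; lra.
have : (1 : R) <= k.+1%:R by rewrite ler1n.
rewrite -[k.+2%:R]natr1; lra.
Qed.

(** I r t is the energy of a heat kernel at time t outside radius r and J t its total
    energy, scaled so that the latter is 1 at time 0. The parameter l is the slope of an
    exponential weight that equals 1 outside radius r; the restriction l <= 1/2 comes from
    the discreteness of the space. *)
Record energy_bounds I J : Prop := EnergyBounds {
  eb_ge0 : forall r t, 0 <= I r t;
  eb_step : forall l r r' s t, 0 <= l -> l <= 2^-1 -> 0 <= s -> s <= t -> r' <= r ->
    I r t <= expR (4 * l ^+ 2 * (t - s)) *
      (I r' s + expR (- (2 * l * (r - r'))) * J s);
  eb_init : forall l r t, 0 <= l -> l <= 2^-1 -> 0 <= t -> 0 <= r ->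
    I r t <= expR (4 * l ^+ 2 * t - 2 * l * r);
  eb_mono : forall r s t, r <= s -> I s t <= I r t;
  eb_total : forall r t, I r t <= J t }.

Lemma stopping_index (x : R) : 1 <= x -> exists K, [/\ x <= 4 ^+ K,
  4 ^+ K <= 4 * x & forall k, (k < K)%N -> 4 ^+ k <= x].
Proof.
move=> x1; have ex : exists K, x <= 4 ^+ K.
  exists (Num.truncn x); apply: (@le_trans _ _ (Num.truncn x).+1%:R).
    by rewrite ltW // truncnS_gt.
  by apply: natr_le_expn; lra.
exists (ex_minn ex); case: ex_minnP => K xK Kmin.
have small k : (k < K)%N -> 4 ^+ k <= x.
  move=> kK; rewrite leNgt; apply/negP => /ltW /Kmin.
  by rewrite leqNgt kK.
split=> //; case: K {xK Kmin} small => [_|K /(_ K (ltnSn K))]; last by rewrite exprS; lra.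
by rewrite expr0; lra.
Qed.

(** Grigor'yan's iteration along tim k = tau / 4^k and rad k = r / 2 * (1 + (3/4)^k).
    Let B k = (r^2 / tau) (9/4)^k. A step from (rad k, tim k) to (rad (k+1), tim (k+1)),
    with slope proportional to the ratio of the increments, costs a factor
    expR (B k / 768) and leaves the term expR (- B k / 192) J (tim (k+1)). Since B grows
    geometrically, the factors accumulated before step k stay below expR (B k / 960), so
    that these terms are dominated by q^(k+1) with q = expR (- r^2 / tau / 500), even
    after J has been bounded by M expR (2 L (k+1)).
    The slopes must stay below 1/2, which is why the iteration stops at the first K with
    tau <= r 4^K. Then tim K <= r, and [eb_init] with slope 1/8 bounds what remains by a
    negative exponential of r that compensates the growth in the last hypothesis. *)
Lemma energy_iteration I J A M L r tau : energy_bounds I J ->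
  0 <= M -> 1 <= A -> 0 <= L -> 0 < r -> r <= tau -> 1 <= r ^+ 2 / tau ->
  L <= r ^+ 2 / tau / 4 / 4 / 5 / 5 / 10 ->
  (forall k, J (tau / 4 ^+ k.+1) <= M * expR (2 * L * k.+1%:R)) ->
  (forall k, 1 <= M * A * expR (2 * L * k%:R + tau / 2 / 4 / 4 / 4 ^+ k)) ->
  I r tau <= (4 * 5 * 5 * 5 + 2) * (M * A) * expR (- (r ^+ 2 / tau / 4 / 5 / 5 / 5)).
Proof.
move=> IJ M0 A1 L0 r0 rt a1 La HJ HM.
have t0 : 0 < tau by lra.
have [a aE] : exists a, a = r ^+ 2 / tau by exists (r ^+ 2 / tau).
rewrite -!aE in a1 La *.
have atE : a * tau = r ^+ 2 by rewrite aE divfK ?gt_eqF.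
have ar : a <= r by rewrite aE ler_pdivrMr // expr2 ler_pM2l.
have tr1 : 1 <= tau / r by rewrite ler_pdivlMr ?mul1r.
have [K [K1 K2 K3]] := stopping_index tr1.
pose B k := a * (9 / 4) ^+ k.
pose rad k := r / 2 * (1 + (3 / 4) ^+ k).
pose tim k := tau / 4 ^+ k.
pose W k := expR (B k / 3 / 4 / 4 / 4 / 5) * I (rad k) (tim k).
pose q := expR (- (a / 4 / 5 / 5 / 5)).
have p4 k : 0 < (4 : R) ^+ k by rewrite exprn_gt0.
have BS k : B k.+1 = 9 / 4 * B k by rewrite /B exprS mulrCA.
have Bge k : a * k.+1%:R <= B k.
  rewrite /B ler_wpM2l //; first lra.
  by apply: natr_le_expn; lra.
have B0 k : 0 <= B k by apply: le_trans (Bge k); rewrite mulr_ge0 //; lra.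
have step k : (k < K)%N -> W k <= W k.+1 + M * q ^+ k.+1.
  (* One eighth of (rad k - rad k.+1) / (tim k - tim k.+1). *)
  move=> kK; pose l := r / tau / 3 / 4 / 4 * 3 ^+ k.
  have l0 : 0 <= l by rewrite !mulr_ge0 ?invr_ge0 ?exprn_ge0 //; lra.
  have l2 : l <= 2^-1.
    have : r / tau * 3 ^+ k <= 1.
      apply: (@le_trans _ _ (r / tau * (tau / r))).
        rewrite ler_pM2l ?divr_gt0 //; apply: le_trans (K3 k kK).
        by rewrite lerXn2r ?nnegrE //; lra.
      by rewrite mulrA divfK ?gt_eqF // divff ?gt_eqF.
    by rewrite /l; lra.
  have tS : tim k.+1 = tim k / 4 by rewrite /tim exprSr invfM mulrA.
  have tk0 : 0 < tim k by rewrite divr_gt0.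
  have E1 : 4 * l ^+ 2 * (tim k - tim k.+1) = B k / 3 / 4 / 4 / 4 / 4.
    have E39 : (3 : R) ^+ k ^+ 2 = 4 ^+ k * (9 / 4) ^+ k.
      by rewrite exprAC -exprMn; congr (_ ^+ _); field.
    rewrite tS /l /B exprMn E39 aE /tim; field.
    by rewrite !gt_eqF.
  have E2 : 2 * l * (rad k - rad k.+1) = B k / 3 / 4 / 4 / 4.
    have E39 : (9 / 4 : R) ^+ k = 3 ^+ k * (3 / 4) ^+ k.
      by rewrite -exprMn; congr (_ ^+ _); field.
    by rewrite /l /B E39 aE /rad exprS; field; rewrite gt_eqF.
  have rS : rad k.+1 <= rad k.
    have : 0 <= r * (3 / 4 : R) ^+ k by rewrite mulr_ge0 ?exprn_ge0 //; lra.
    by rewrite /rad exprS; lra.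
  have := eb_step IJ l0 l2 _ _ rS (s := tim k.+1) (t := tim k).
  rewrite E1 E2 => H.
  have {H} : I (rad k) (tim k) <= expR (B k / 3 / 4 / 4 / 4 / 4) *
      (I (rad k.+1) (tim k.+1) + expR (- (B k / 3 / 4 / 4 / 4)) * J (tim k.+1)).
    by apply: H; rewrite tS; lra.
  rewrite -(ler_pM2l (expR_gt0 (B k / 3 / 4 / 4 / 4 / 5))) -/(W k) => /le_trans; apply.
  rewrite mulrA -expRD mulrDr lerD //.
    by rewrite le_eqVlt /W BS; apply/orP; left; apply/eqP; congr (expR _ * _); field.
  rewrite mulrA -expRD.
  apply: (@le_trans _ _ (expR (- (11 / 3 / 4 / 4 / 4 / 4 / 5 * B k)) *
      (M * expR (2 * L * k.+1%:R)))).
    have -> : B k / 3 / 4 / 4 / 4 / 5 + B k / 3 / 4 / 4 / 4 / 4 + - (B k / 3 / 4 / 4 / 4) =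
        - (11 / 3 / 4 / 4 / 4 / 4 / 5 * B k) by field.
    by rewrite ler_wpM2l ?expR_ge0 // HJ.
  rewrite mulrCA ler_wpM2l // -expRD /q -expRM_natl ler_expR.
  have := Bge k.
  have : 0 <= (a / 4 / 4 / 5 / 5 / 10 - L) * k.+1%:R by rewrite mulr_ge0 //; lra.
  have : 0 <= a * k.+1%:R by rewrite mulr_ge0 //; lra.
  lra.
have chain n : (n <= K)%N -> W 0%N <= W n + M * \sum_(k < n) q ^+ k.+1.
  elim: n => [_|n IHn nK]; first by rewrite big_ord0 mulr0 addr0.
  by have := IHn (ltnW nK); have := step n nK; rewrite big_ord_recr /= mulrDr; lra.
have q0 : 0 < q by exact: expR_gt0.
have q1 : (4 * 5 * 5 * 5 + 1) * q <= 4 * 5 * 5 * 5.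
  have h : (1 + a / 4 / 5 / 5 / 5) * q <= 1.
    by rewrite -[leRHS](expRxMexpNx_1 (a / 4 / 5 / 5 / 5)) ler_wpM2r ?expR_ge0 // expR_ge1Dx.
  have : 0 <= (a - 1) * q by rewrite mulr_ge0 ?expR_ge0 //; lra.
  lra.
have W0 : I r tau <= W 0%N.
  have -> : W 0%N = expR (a / 3 / 4 / 4 / 4 / 5) * I r tau.
    by rewrite /W /B /rad /tim !expr0 mulr1 divr1; congr (_ * I _ _); field.
  by rewrite ler_peMl ?(eb_ge0 IJ) // -[leLHS]expR0 ler_expR; lra.
have WK : W K <= M * A * q.
  have rK : r / 2 <= rad K.
    have : 0 <= r * (3 / 4 : R) ^+ K by rewrite mulr_ge0 ?exprn_ge0 //; lra.
    by rewrite /rad; lra.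
  have r20 : 0 <= r / 2 by lra.
  have tK0 : 0 <= tim K by rewrite ltW // divr_gt0.
  have tKr : tim K <= r.
    by rewrite /tim ler_pdivrMr // mulrC -ler_pdivrMr.
  have := eb_init IJ (l := 8^-1) _ _ tK0 r20.
  have -> : 4 * 8^-1 ^+ 2 * tim K - 2 * 8^-1 * (r / 2) = tim K / 4 / 4 - r / 2 / 4 by field.
  move=> H; have {}H : I (r / 2) (tim K) <= expR (tim K / 4 / 4 - r / 2 / 4) by apply: H; lra.
  have a4K : a * 4 ^+ K <= 4 * r.
    rewrite -(ler_pM2r t0) mulrAC atE expr2.
    have := K2; rewrite -(ler_pM2l (mulr_gt0 r0 r0)) => /le_trans; apply.
    by rewrite le_eqVlt; apply/orP; left; apply/eqP; field; rewrite gt_eqF.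
  have BK : B K <= 4 * r.
    apply: le_trans a4K; rewrite /B ler_wpM2l //; first lra.
    by rewrite lerXn2r ?nnegrE //; lra.
  have LK : 2 * L * K%:R <= r / 4 / 5 / 5 / 5.
    have : K%:R <= (4 : R) ^+ K.
      by apply: le_trans (natr_le_expn K _); rewrite ?ler_nat //; lra.
    move=> K4; have : L * K%:R <= a / 4 / 4 / 5 / 5 / 10 * 4 ^+ K by rewrite ler_pM.
    lra.
  apply: (@le_trans _ _ (expR (B K / 3 / 4 / 4 / 4 / 5) * expR (tim K / 4 / 4 - r / 2 / 4))).
    by rewrite ler_wpM2l ?expR_ge0 // (le_trans _ H) // (eb_mono IJ).
  rewrite -expRD.
  apply: (@le_trans _ _ (expR (B K / 3 / 4 / 4 / 4 / 5 + (tim K / 4 / 4 - r / 2 / 4)) *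
    (M * A * expR (2 * L * K%:R + tau / 2 / 4 / 4 / 4 ^+ K)))).
    by rewrite ler_peMr ?expR_ge0.
  rewrite mulrCA -expRD ler_wpM2l ?mulr_ge0 //; first lra.
  rewrite ler_expR.
  have -> : tau / 2 / 4 / 4 / 4 ^+ K = tim K / 2 / 4 / 4 by rewrite /tim; ring.
  lra.
have := chain K (leqnn K).
have c0 : 0 <= 4 * 5 * 5 * 5 :> R by rewrite !mulr_ge0.
rewrite -/q; have gt := geometric_tail_le K c0 (ltW q0) q1.
have : M * \sum_(k < K) q ^+ k.+1 <= M * ((4 * 5 * 5 * 5 + 1) * q) by rewrite ler_wpM2l.
have : 0 <= M * q * (A - 1) by rewrite !mulr_ge0 //; lra.
lra.
Qed.

End Iteration.

(** * Growth of regular functions *)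

Section RegularGrowth.
Variable R : realType.
Implicit Types (f : R -> R) (A gamma delta s t r : R).

Lemma regular_fun_gt0 A gamma f : regular_fun A gamma f -> forall t, 0 < t -> 0 < f t.
Proof. by case. Qed.

Lemma regular_fun_le A gamma f : regular_fun A gamma f ->
  forall s t, 0 <= s -> s <= t -> f s <= f t.
Proof. by case. Qed.

(** Telescoping: for positive arguments, (A, gamma)-regularity implies
    (A^j, gamma^j)-regularity. *)
Lemma regular_fun_iter A gamma f j s t : 1 <= A -> 0 < gamma ->
  regular_fun A gamma f -> 0 < s -> s <= t ->
  f (gamma ^+ j * s) / f s <= A ^+ j * (f (gamma ^+ j * t) / f t).
Proof.
move=> A1 g0 rf s0 st.
have fp := regular_fun_gt0 rf.
have t0 : 0 < t by exact: lt_le_trans st.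
move: st; rewrite le_eqVlt => /predU1P[<-|st].
  by rewrite ler_peMl ?exprn_ege1 // divr_ge0 // ltW // fp // mulr_gt0 // exprn_gt0.
elim: j => [|j IHj].
  by rewrite !expr0 !mul1r !divff // gt_eqF // fp.
have gj u : 0 < u -> 0 < gamma ^+ j * u by move=> u0; rewrite mulr_gt0 // exprn_gt0.
have split u : 0 < u -> f (gamma ^+ j.+1 * u) / f u =
    f (gamma * (gamma ^+ j * u)) / f (gamma ^+ j * u) * (f (gamma ^+ j * u) / f u).
  move=> u0; rewrite exprS -mulrA; field.
  by rewrite !gt_eqF ?fp // gj.
rewrite !split // [A ^+ _]exprS [leRHS]mulrACA.
have q0 u : 0 < u -> 0 <= f (gamma ^+ j * u) / f u.
  by move=> u0; rewrite divr_ge0 // ltW // fp // gj.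
apply: ler_pM => //; last 1 first.
- case: rf => _ _ _; apply; first by rewrite ltW // gj.
  by rewrite ltr_pM2l // exprn_gt0.
- by rewrite divr_ge0 // ltW // fp // ?gj // mulr_gt0 // gj.
- exact: q0.
Qed.

Lemma doubling_iter f s l k : (forall u, 0 < u -> u <= s -> f (2 * u) <= expR l * f u) ->
  0 < s -> f s <= expR (2 * l * k%:R) * f (s / 4 ^+ k).
Proof.
move=> dbl s0; elim: k => [|k IHk]; first by rewrite mulr0 expR0 expr0 divr1 mul1r.
apply: le_trans IHk _.
have p4 : 0 < (4 : R) ^+ k.+1 by rewrite exprn_gt0.
have p4' : 0 < (4 : R) ^+ k by rewrite exprn_gt0.
have g1 : 1 <= (4 : R) ^+ k by rewrite exprn_ege1 //; lra.
pose v := s / 4 ^+ k.+1.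
have v0 : 0 < v by rewrite divr_gt0.
have v4 : s / 4 ^+ k = 2 * (2 * v).
  by rewrite /v exprS; field; rewrite gt_eqF.
have vs : 2 * (2 * v) <= s by rewrite -v4 ler_pdivrMr // ler_peMr // ltW.
have d1 : f (2 * v) <= expR l * f v by apply: dbl => //; lra.
have d2 : f (2 * (2 * v)) <= expR l * f (2 * v) by apply: dbl; lra.
have -> : 2 * l * k.+1%:R = 2 * l * k%:R + (l + l) by rewrite -[k.+1%:R]natr1; ring.
rewrite v4 -/v [in leRHS]expRD -[leRHS]mulrA; apply: ler_wpM2l; first exact: expR_ge0.
rewrite expRD -[leRHS]mulrA; apply: le_trans d2 _.
by apply: ler_wpM2l => //; exact: expR_ge0.
Qed.

(** Put s0 = alpha t and expR l = A^b f (gamma^b s0) / f s0. By regularity and gamma^b >= 2,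
    f grows at most by the factor expR l in each doubling below s0. If l is large compared
    to r^2 / t, then expR l exceeds the inverse of the Gaussian factor and, because
    gamma^b s0 <= t, the bound 1 / f t on the total energy suffices. Otherwise the
    iteration applies, with M = 1 / f s0. The exponential bound on f controls the
    remainder of the iteration: it gives f (s0 / 4^k) <= A expR (t / 64 / 4^k), which is
    small compared to an exponential of r when t / 4^k is of the order of r. *)
Lemma far_energy_gaussian (I : R -> R -> R) (J f : R -> R) A gamma delta alpha b t r :
  energy_bounds I J -> (forall s, 0 < s -> J s <= (f (2 * s))^-1) ->
  1 <= A -> 1 < gamma -> 1 <= delta -> regular_fun A gamma f ->
  (forall s, 0 <= s -> f s <= A * expR (delta * s)) ->
  (0 < b)%N -> 2 <= gamma ^+ b -> gamma ^+ b <= 2 * gamma ->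
  0 < alpha -> alpha <= (2 * gamma)^-1 -> alpha <= (64 * delta)^-1 ->
  0 < t -> 0 <= r -> r <= t / 2 ->
  I r (t / 2) <= (4 * 5 * 5 * 5 + 2) * (A ^+ b / f (alpha * t)) *
    expR (- (r ^+ 2 / (t / 2) / 4 / 4 / 5 / 5 / 10)).
Proof.
move=> IJ HJ A1 g1 d1 rf fe b0 g2 gg al0 alg ald t0 r0 rt.
have A0 : 0 <= A by lra.
have Ab0 : 0 <= A ^+ b by rewrite exprn_ge0.
have fp := regular_fun_gt0 rf; have fm := regular_fun_le rf.
have al1 : alpha * gamma ^+ b <= 1.
  apply: (@le_trans _ _ ((2 * gamma)^-1 * (2 * gamma))).
    by rewrite ler_pM // ltW // exprn_gt0 //; lra.
  by rewrite mulVf // gt_eqF //; lra.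
have al2 : delta * alpha <= 4^-1 / 4 / 4.
  apply: (@le_trans _ _ (delta * (64 * delta)^-1)).
    by rewrite ler_wpM2l //; lra.
  rewrite invfM mulrCA divff ?mulr1; last by rewrite gt_eqF //; lra.
  by lra.
clear alg ald.
have alpha_le1 : alpha <= 1.
  have : 0 <= alpha * (delta - 1) by rewrite mulr_ge0 //; lra.
  lra.
set s0 := alpha * t; have s00 : 0 < s0 by rewrite mulr_gt0.
have s0t : s0 <= t by rewrite ler_piMl // ltW.
have gst : gamma ^+ b * s0 <= t.
  by rewrite mulrA [_ * alpha]mulrC ler_piMl // ltW.
have f0 := fp _ s00.
have Ab1 : 1 <= A ^+ b by rewrite exprn_ege1.
have AAb : A <= A ^+ b.
  by case: b b0 {g2 gg al1 gst Ab1 Ab0} => // b _; rewrite exprS ler_peMr ?exprn_ege1.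
pose Q := A ^+ b * (f (gamma ^+ b * s0) / f s0).
have gs0 : s0 <= gamma ^+ b * s0 by rewrite ler_peMl //; lra.
have Q1 : 1 <= Q.
  rewrite /Q; apply: (@le_trans _ _ (1 * 1)); first by rewrite mulr1.
  by rewrite ler_pM // ler_pdivlMr // mul1r fm // ltW.
have Qf : Q <= A ^+ b * (f t / f s0).
  rewrite ler_wpM2l // ler_wpM2r ?invr_ge0 ?(ltW f0) // fm //.
  exact: le_trans (ltW s00) gs0.
pose l := ln Q.
have l0 : 0 <= l by rewrite ln_ge0.
have El : expR l = Q by rewrite lnK // posrE; lra.
have dbl u : 0 < u -> u <= s0 -> f (2 * u) <= expR l * f u.
  move=> u0 us; rewrite El -ler_pdivrMr ?fp //.
  apply: le_trans (regular_fun_iter b A1 _ rf u0 us); last lra.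
  rewrite ler_wpM2r ?invr_ge0 ?(ltW (fp _ u0)) // fm //; first lra.
  by rewrite ler_wpM2r // ltW.
have [a aE] : exists a, a = r ^+ 2 / (t / 2) by exists (r ^+ 2 / (t / 2)).
rewrite -aE.
have t20 : 0 < t / 2 by lra.
have a0 : 0 <= a by rewrite aE divr_ge0 ?sqr_ge0 // ltW.
have triv : I r (t / 2) <= (f t)^-1.
  apply: le_trans (eb_total IJ r _) _.
  by rewrite -[t in leRHS](divfK (_ : 2 != 0)) // [_ / 2 * 2]mulrC HJ.
have [la|la] := ltP (a / 4 / 4 / 5 / 5 / 10) l.
  have {}Qf : expR (a / 4 / 4 / 5 / 5 / 10) <= A ^+ b * (f t / f s0).
    by apply: le_trans Qf; rewrite -El ler_expR ltW.
  have ft := fp _ t0.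
  apply: le_trans triv _; set e := expR (- _); have e0 : 0 < e by exact: expR_gt0.
  have X0 : 0 <= A ^+ b / f s0 * e by rewrite !mulr_ge0 ?invr_ge0 // ltW //; lra.
  suff : (f t)^-1 <= A ^+ b / f s0 * e by lra.
  rewrite -[leLHS]mul1r ler_pdivrMr //.
  rewrite -[leLHS](expRxMexpNx_1 (a / 4 / 4 / 5 / 5 / 10)) -/e.
  have -> : A ^+ b / f s0 * e * f t = A ^+ b * (f t / f s0) * e by ring.
  by rewrite ler_wpM2r // ltW.
have [a1|a1] := ltP a 1.
  apply: le_trans triv _; set e := expR (- _).
  have e1 : 2^-1 <= e by apply: le_trans (expR_ge1Dx _); lra.
  have X0 : (f t)^-1 <= A ^+ b / f s0.
    apply: (@le_trans _ _ (f s0)^-1); last by rewrite ler_peMl // invr_ge0 ltW.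
    by rewrite lef_pV2 ?posrE ?fp // fm // ltW.
  have : 0 <= A ^+ b / f s0 * (e - 2^-1).
    by rewrite mulr_ge0 ?subr_ge0 // mulr_ge0 ?invr_ge0 // ltW //; lra.
  have : 0 <= A ^+ b / f s0 by rewrite mulr_ge0 ?invr_ge0 // ltW //; lra.
  lra.
have rpos : 0 < r.
  rewrite lt_def r0 andbT; apply/eqP => rr; move: a1; rewrite aE rr expr0n /= mul0r; lra.
have := @energy_iteration R I J A (f s0)^-1 l r (t / 2) IJ.
rewrite -aE => H.
apply: le_trans (H _ A1 l0 rpos rt a1 la _ _) _ => {H}.
- by rewrite invr_ge0 ltW.
- move=> k; have p4 : 0 < (4 : R) ^+ k.+1 by rewrite exprn_gt0.
  apply: le_trans (HJ _ _) _; first by rewrite divr_gt0.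
  have := @doubling_iter f s0 l k.+1 dbl s00.
  have fk : 0 < f (s0 / 4 ^+ k.+1) by rewrite fp // divr_gt0.
  have e : 2 * (t / 2 / 4 ^+ k.+1) = t / 4 ^+ k.+1 by field; rewrite gt_eqF.
  rewrite e -ler_pdivrMr // => D.
  apply: (@le_trans _ _ (f (s0 / 4 ^+ k.+1))^-1).
    rewrite lef_pV2 ?posrE ?fp ?divr_gt0 // fm ?ler_pM2r ?invr_gt0 //.
    by rewrite divr_ge0 // ltW.
  by rewrite ler_pdivlMl.
- move=> k; have p4 : 0 < (4 : R) ^+ k by rewrite exprn_gt0.
  rewrite -mulrA ler_pdivlMl // mulr1.
  apply: le_trans (@doubling_iter f s0 l k dbl s00) _.
  rewrite expRD mulrCA ler_wpM2l ?expR_ge0 //.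
  apply: le_trans (fe _ _) _; first by rewrite divr_ge0 // ltW.
  rewrite ler_wpM2l //.
  rewrite ler_expR mulrA ler_pM2r ?invr_gt0 // /s0 mulrA.
  have : delta * alpha * t <= 4^-1 / 4 / 4 * t by rewrite ler_wpM2r // ltW.
  lra.
have fA : (f s0)^-1 * A <= A ^+ b / f s0 by rewrite mulrC ler_wpM2r // invr_ge0 ltW.
have e0 : expR (- (a / 4 / 5 / 5 / 5)) <= expR (- (a / 4 / 4 / 5 / 5 / 10)).
  by rewrite ler_expR; lra.
apply: ler_pM; rewrite ?expR_ge0 //; last by lra.
have : 0 <= (f s0)^-1 * A by rewrite mulr_ge0 ?invr_ge0 ?(ltW f0) //; lra.
lra.
Qed.

Lemma ceil_log2 gamma : 1 < gamma -> exists b : nat,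
  [/\ Num.ceil (ln 2 / ln gamma) = b%:Z, (0 < b)%N, 2 <= gamma ^+ b &
      gamma ^+ b <= 2 * gamma].
Proof.
move=> g1; have g0 : 0 < gamma by lra.
have lg : 0 < ln gamma by rewrite ln_gt0.
have l2 : 0 < ln (2 : R) by rewrite ln_gt0 //; lra.
have x0 : 0 < ln 2 / ln gamma by rewrite divr_gt0.
have c0 : 0 < Num.ceil (ln 2 / ln gamma) by rewrite ceil_gt0.
have := ceil_ge (ln 2 / ln gamma); have := ceilB1_lt (ln 2 / ln gamma).
case: (Num.ceil _) c0 => // b b0; rewrite intrB ltr_pdivlMr // => lo hi.
exists b; split=> //.
  rewrite -ler_ln ?posrE ?exprn_gt0 // lnXn // -[leRHS]mulr_natl.
  by rewrite -ler_pdivrMr.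
rewrite -ler_ln ?posrE ?exprn_gt0 ?mulr_gt0 // lnXn // lnM ?posrE //.
by rewrite -[leLHS]mulr_natl; move: lo; rewrite mulrBl mul1r => lo; rewrite -lerBlDr ltW.
Qed.

End RegularGrowth.

(** * Energy outside balls and the off-diagonal bound *)

Lemma expR_half_le2 (R : realType) : expR (2^-1 : R) <= 2.
Proof.
have h := expR_ge1Dx (- 2^-1 : R); have p := expR_gt0 (2^-1 : R).
have : expR (2^-1) * (1 - 2^-1) <= 1 :> R.
  by rewrite -[leRHS](expRxMexpNx_1 2^-1) ler_pM2l.
lra.
Qed.

Lemma expR_addN_le (R : realType) (x : R) : `|x| <= 2^-1 ->
  expR x + expR (- x) <= 2 + 4 * x ^+ 2.
Proof.
move=> xh; have /andP[_ h1] := expR_sub1_sub_le x.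
have /andP[_] := expR_sub1_sub_le (- x); rewrite normrN sqrrN => h2.
have e2 : expR `|x| * x ^+ 2 <= 2 * x ^+ 2.
  rewrite ler_wpM2r ?sqr_ge0 // (le_trans _ (expR_half_le2 R)) //.
  by rewrite ler_expR.
lra.
Qed.

(** The Cauchy-Schwarz inequality, with bounds in place of the sums of squares. *)
Lemma sum_mul_le_sqrt (R : realType) (I : Type) (s : seq I) (p : pred I)
    (a b w : I -> R) (P Q : R) : (forall i, 0 <= w i) -> 0 < P -> 0 < Q ->
  \sum_(i <- s | p i) a i ^+ 2 * w i <= P -> \sum_(i <- s | p i) b i ^+ 2 * w i <= Q ->
  \sum_(i <- s | p i) a i * b i * w i <= Num.sqrt (P * Q).
Proof.
move=> w0 P0 Q0 aP bQ; rewrite sqrtrM ?(ltW P0) //.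
set x := Num.sqrt P; set y := Num.sqrt Q.
have x0 : 0 < x by rewrite sqrtr_gt0.
have y0 : 0 < y by rewrite sqrtr_gt0.
have xP : P = x ^+ 2 by rewrite sqr_sqrtr // ltW.
have yQ : Q = y ^+ 2 by rewrite sqr_sqrtr // ltW.
have xy0 : 0 < x * y by rewrite mulr_gt0.
rewrite -(ler_pM2l xy0) -(@ler_pM2l _ 2) //.
apply: (@le_trans _ _ (\sum_(i <- s | p i)
    (y ^+ 2 * (a i ^+ 2 * w i) + x ^+ 2 * (b i ^+ 2 * w i)))).
  rewrite !mulr_sumr; apply: ler_sum => i _.
  have : 0 <= (y * a i - x * b i) ^+ 2 * w i by rewrite mulr_ge0 ?sqr_ge0.
  lra.
rewrite big_split /= -!mulr_sumr -xP -yQ.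
have : Q * (\sum_(i <- s | p i) a i ^+ 2 * w i) <= Q * P by rewrite ler_wpM2l // ltW.
have : P * (\sum_(i <- s | p i) b i ^+ 2 * w i) <= P * Q by rewrite ler_wpM2l // ltW.
have -> : 2 * (x * y * (x * y)) = P * Q + Q * P by rewrite xP yQ; ring.
lra.
Qed.

Section FarEnergy.
Variables (R : realType) (V : metricType R) (F : seq V) (q : V -> R)
  (rate : V -> V -> R) (a : nat -> R -> V -> V -> R) (nu : V -> R).
Hypotheses (F_uniq : uniq F) (rate_ge0 : forall x y, 0 <= rate x y)
  (ka : graded_kernel F q rate a) (nu_gt0 : forall x, 0 < nu x)
  (rate_sym : forall x y, nu x * rate x y = nu y * rate y x).
Hypotheses (rate_adapted : forall y, \sum_(z <- F) rate y z * mdist y z ^+ 2 <= 1)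
  (rate_total : forall y, \sum_(z <- F) rate y z <= q y)
  (rate_short : forall y z, 1 < mdist y z -> rate y z = 0).
Implicit Types (x y z : V) (s t l r : R) (N : nat).

(** Edges have length at most 1, so psi varies by at most 1/2 along an edge, where
    expR x + expR (- x) <= 2 + 4 x^2; the adapted metric makes the squares sum up to at
    most l^2. *)
Lemma twisted_rate_lipschitz (psi : V -> R) l : 0 <= l -> l <= 2^-1 ->
  (forall y z, `|psi y - psi z| <= l * mdist y z) ->
  twisted_rate F q rate psi (4 * l ^+ 2).
Proof.
move=> l0 l2 lip y _.
apply: (@le_trans _ _ (\sum_(z <- F)
   (2 * rate y z + 4 * l ^+ 2 * (rate y z * mdist y z ^+ 2)))).
  apply: ler_sum => z _; have [d1|/rate_short->] := leP (mdist y z) 1; last first.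
    by rewrite !mul0r !mulr0 addr0.
  rewrite [2 * _]mulrC mulrCA -mulrDr ler_wpM2l // -[psi z - _]opprB.
  have lp := lip y z.
  have dle : `|psi y - psi z| <= 2^-1.
    by apply: le_trans lp _; rewrite -[leRHS]mulr1 ler_pM // mdist_ge0.
  apply: le_trans (expR_addN_le dle) _; rewrite lerD2l -mulrA ler_wpM2l //.
  by rewrite -exprMn -real_normK ?num_real // ler_sqr ?nnegrE // mulr_ge0 // mdist_ge0.
rewrite big_split /= -!mulr_sumr lerD // ?ler_wpM2l //.
by rewrite ler_piMr // mulr_ge0 ?sqr_ge0.
Qed.

Definition far_energy N x r t : R :=
  \sum_(y <- F | r <= mdist x y) trunc_kernel a N t x y ^+ 2 / nu y.

Definition total_energy N x t : R := \sum_(y <- F) trunc_kernel a N t x y ^+ 2 / nu y.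

Lemma energy_term_ge0 N x t y : 0 <= trunc_kernel a N t x y ^+ 2 / nu y.
Proof. by rewrite divr_ge0 ?sqr_ge0 // (ltW (nu_gt0 y)). Qed.

Lemma far_energy_le_total N x r t : far_energy N x r t <= total_energy N x t.
Proof.
rewrite /total_energy (bigID (fun y => r <= mdist x y)) /= lerDl sumr_ge0 // => y _.
exact: energy_term_ge0.
Qed.

Lemma le_far_energy N x r s t : r <= s -> far_energy N x s t <= far_energy N x r t.
Proof.
move=> rs; rewrite /far_energy big_mkcond [leRHS]big_mkcond; apply: ler_sum => y _.
have [sd|_] := boolP (s <= mdist x y); first by rewrite (le_trans rs sd).
by case: ifP => // _; exact: energy_term_ge0.
Qed.

Definition cutoff l x r y := l * Num.min (mdist x y - r) 0.

Lemma cutoff_lipschitz l x r y z : 0 <= l ->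
  `|cutoff l x r y - cutoff l x r z| <= l * mdist y z.
Proof.
move=> l0; rewrite -mulrBr normrM ger0_norm // ler_wpM2l //.
have t1 := metric_triangle x y z; have t2 := metric_triangle x z y.
rewrite [mdist z y]metric_sym in t2; have t3 := mdist_ge0 y z.
rewrite ler_norml; apply/andP; split; rewrite !minEle; case: ifP; case: ifP; lra.
Qed.

Lemma far_energy_le_cutoff N x l r t :
  far_energy N x r t <= energy F a nu N x (fun y => expR (2 * cutoff l x r y)) t.
Proof.
rewrite /far_energy big_mkcond; apply: ler_sum => y _.
rewrite [leRHS]mulrAC; case: ifP => [rd|_]; last first.
  by rewrite mulr_ge0 ?expR_ge0 // energy_term_ge0.
by rewrite /cutoff (min_idPr _) ?subr_ge0 // !mulr0 expR0 mulr1.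
Qed.

Lemma energy_cutoff_step N x l r s t : 0 <= l -> l <= 2^-1 -> 0 <= s -> s <= t ->
  far_energy N x r t <= expR (4 * l ^+ 2 * (t - s)) *
    energy F a nu N x (fun y => expR (2 * cutoff l x r y)) s.
Proof.
move=> l0 l2 s0 st; apply: le_trans (far_energy_le_cutoff N x l r t) _.
apply: (energy_twisted_le ka rate_sym rate_ge0 nu_gt0 N x _ s0 st).
by apply: twisted_rate_lipschitz => // y z; exact: cutoff_lipschitz.
Qed.

(** The weight expR (2 * cutoff) is 1 outside radius r, at most 1 everywhere, and at most
    expR (- 2 l (r - r')) inside radius r'. *)
Lemma far_energy_step N x l r r' s t : 0 <= l -> l <= 2^-1 -> 0 <= s -> s <= t ->
  r' <= r ->
  far_energy N x r t <= expR (4 * l ^+ 2 * (t - s)) *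
    (far_energy N x r' s + expR (- (2 * l * (r - r'))) * total_energy N x s).
Proof.
move=> l0 l2 s0 st rr; apply: le_trans (energy_cutoff_step N x r l0 l2 s0 st) _.
rewrite ler_wpM2l ?expR_ge0 // /far_energy big_mkcond mulr_sumr -big_split /=.
apply: ler_sum => y _; rewrite [leLHS]mulrAC.
have e0 := energy_term_ge0 N x s y.
case: ifP => [_|/negbT]; last rewrite -ltNge => dr.
  rewrite -[leLHS]addr0; apply: lerD; last by rewrite mulr_ge0 ?expR_ge0.
  apply: ler_piMr => //.
  by rewrite -expR0 ler_expR /cutoff mulr_ge0_le0 // mulr_ge0_le0 // ge_min lexx orbT.
rewrite add0r mulrC ler_wpM2r // ler_expR /cutoff (min_idPl _); last lra.
have : l * (mdist x y) <= l * r' by rewrite ler_wpM2l // ltW.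
lra.
Qed.

(** At time 0 the energy is concentrated at x, where the weight is expR (- 2 l r). *)
Lemma far_energy_init N x l r t : 0 <= l -> l <= 2^-1 -> 0 <= t -> 0 <= r -> x \in F ->
  far_energy N.+1 x r t <= expR (4 * l ^+ 2 * t - 2 * l * r) / nu x.
Proof.
move=> l0 l2 t0 r0 xF.
apply: le_trans (energy_cutoff_step N.+1 x r l0 l2 (lexx 0) t0) _.
rewrite subr0 expRD -[leRHS]mulrA ler_wpM2l ?expR_ge0 //.
rewrite /energy (bigD1_seq x) //= big1 ?addr0 => [|y /negPf yx]; last first.
  by rewrite (trunc_kernel_init ka) eq_sym yx expr0n /= !mul0r.
rewrite (trunc_kernel_init ka) eqxx expr1n mul1r /cutoff mdistxx sub0r.
rewrite (min_idPl _) ?oppr_le0 // ler_wpM2r ?invr_ge0 ?(ltW (nu_gt0 x)) //.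
by rewrite ler_expR; lra.
Qed.

Local Notation u := (trunc_kernel a).
Local Notation far := far_energy.
Local Notation total := total_energy.

(** By symmetry, the squared norm of the kernel at time t is a Chapman-Kolmogorov sum for
    the return to x at time 2 t. *)
Lemma total_energy_le N x t : 0 <= t -> x \in F ->
  nu x * total N x t <= u (N + N) (2 * t) x x.
Proof.
move=> t0 xF; rewrite mulrDl mul1r.
apply: le_trans (trunc_kernelD_ge F_uniq ka N x t0 t0 xF).
rewrite le_eqVlt; apply/orP; left; apply/eqP.
rewrite /total_energy mulr_sumr; apply: eq_big_seq => z zF.
have sym := trunc_kernel_symmetry F_uniq ka rate_sym N t0 xF zF.
rewrite expr2 mulrA mulrA sym; field; rewrite gt_eqF //.
Qed.

Lemma far_energy_bounds N x : x \in F ->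
  energy_bounds (fun r t => nu x * far N.+1 x r t) (fun t => nu x * total N.+1 x t).
Proof.
move=> xF; have nx := ltW (nu_gt0 x); split.
- move=> r t; rewrite mulr_ge0 //; apply: sumr_ge0 => y _.
  exact: energy_term_ge0.
- move=> l r r' s t l0 l2 s0 st rr.
  rewrite [X in _ * (_ + X)]mulrCA -mulrDr mulrCA ler_wpM2l //.
  exact: far_energy_step.
- move=> l r t l0 l2 t0 r0; rewrite mulrC -ler_pdivlMr //.
  exact: far_energy_init.
- by move=> r s t rs; rewrite ler_wpM2l // le_far_energy.
- by move=> r t; rewrite ler_wpM2l // far_energy_le_total.
Qed.

(** In the Chapman-Kolmogorov sum at the middle time t / 2, every intermediate state is at
    distance at least r from x1 or from x2. On either part, the Cauchy-Schwarz inequality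
    involves the far energy of one of the two points and the total energy of the other. *)
Lemma off_diagonal_le N x1 x2 t r m1 m2 g : x1 \in F -> x2 \in F ->
  0 < t -> 2 * r <= mdist x1 x2 -> 0 < m1 -> 0 < m2 -> 0 < g ->
  nu x1 * far N x1 r (t / 2) <= g * m1 -> nu x1 * total N x1 (t / 2) <= m1 ->
  nu x2 * far N x2 r (t / 2) <= g * m2 -> nu x2 * total N x2 (t / 2) <= m2 ->
  u N t x1 x2 <= 2 * Num.sqrt (nu x2 / nu x1) * Num.sqrt (m1 * m2) * Num.sqrt g.
Proof.
move=> x1F x2F t0 rd m10 m20 g0 far1 tot1 far2 tot2.
have n1 := nu_gt0 x1; have n2 := nu_gt0 x2.
have t20 : 0 <= t / 2 by lra.
pose c z := u N (t / 2) x1 z * u N (t / 2) x2 z * (nu z)^-1.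
have c0 z : 0 <= c z.
  by rewrite /c !mulr_ge0 ?invr_ge0 ?(ltW (nu_gt0 z)) // (trunc_kernel_ge0 ka).
have w0 z : 0 <= (nu z)^-1 by rewrite invr_ge0 ltW.
have half (p : pred V) P1 P2 : 0 < P1 -> 0 < P2 ->
    \sum_(z <- F | p z) u N (t / 2) x1 z ^+ 2 / nu z <= P1 / nu x1 ->
    \sum_(z <- F | p z) u N (t / 2) x2 z ^+ 2 / nu z <= P2 / nu x2 ->
    \sum_(z <- F | p z) c z <= Num.sqrt (P1 / nu x1 * (P2 / nu x2)).
  by move=> P10 P20; apply: sum_mul_le_sqrt => //; rewrite divr_gt0.
have toE x P e : 0 < nu x -> nu x * e <= P -> e <= P / nu x.
  by move=> nx; rewrite ler_pdivlMr // mulrC.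
have total_cond (p : pred V) x : \sum_(z <- F | p z) u N (t / 2) x z ^+ 2 / nu z <=
    total N x (t / 2).
  rewrite /total_energy [leRHS](bigID p) /= lerDl sumr_ge0 // => z _.
  exact: energy_term_ge0.
have S1 : \sum_(z <- F | r <= mdist x1 z) c z <=
    Num.sqrt (g * m1 / nu x1 * (m2 / nu x2)).
  apply: half => //; first by rewrite mulr_gt0.
    exact: toE far1.
  exact: le_trans (total_cond _ _) (toE _ _ _ n2 tot2).
have S2 : \sum_(z <- F | r <= mdist x2 z) c z <=
    Num.sqrt (m1 / nu x1 * (g * m2 / nu x2)).
  apply: half => //; first by rewrite mulr_gt0.
    exact: le_trans (total_cond _ _) (toE _ _ _ n1 tot1).
  exact: toE far2.
have S : u N t x1 x2 <= nu x2 * (\sum_(z <- F | r <= mdist x1 z) c z +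
    \sum_(z <- F | r <= mdist x2 z) c z).
  have {1}-> : t = t / 2 + t / 2 by lra.
  apply: le_trans (trunc_kernelD_le F_uniq ka N x1 t20 t20 x2F) _.
  rewrite [X in _ * (X + _)]big_mkcond [X in _ * (_ + X)]big_mkcond -big_split /=.
  rewrite mulr_sumr !big_seq; apply: ler_sum => z zF.
  have sym := trunc_kernel_symmetry F_uniq ka rate_sym N t20 zF x2F.
  have -> : u N (t / 2) x1 z * u N (t / 2) z x2 = nu x2 * c z.
    rewrite /c -[u N (t / 2) z x2](mulKf (_ : nu z != 0)) ?gt_eqF // sym.
    by ring.
  rewrite ler_wpM2l ?(ltW n2) //.
  have [d1|d1] := leP r (mdist x1 z).
    by rewrite lerDl; case: ifP.
  have [d2|d2] := leP r (mdist x2 z); first by rewrite add0r.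
  have := metric_triangle x1 z x2; rewrite [mdist z x2]metric_sym; lra.
apply: le_trans S _.
apply: (@le_trans _ _ (nu x2 * (2 * Num.sqrt (g * m1 / nu x1 * (m2 / nu x2))))).
  rewrite ler_wpM2l ?(ltW n2) //.
  have E : m1 / nu x1 * (g * m2 / nu x2) = g * m1 / nu x1 * (m2 / nu x2) by ring.
  by move: S2; rewrite E; lra.
rewrite le_eqVlt; apply/orP; left; apply/eqP.
rewrite -{1}[nu x2]ger0_norm ?(ltW n2) // -sqrtr_sqr mulrCA.
have gm : 0 <= nu x2 / nu x1 by rewrite divr_ge0 // ltW.
have mm : 0 <= m1 * m2 by rewrite mulr_ge0 // ltW.
rewrite -!mulrA -sqrtrM ?sqr_ge0 // -sqrtrM // -sqrtrM //.
  by congr (_ * Num.sqrt _); field; rewrite !gt_eqF.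
exact: sqr_ge0.
Qed.

End FarEnergy.

(** * Jump chain and holding times *)

Lemma le_of_expR_factor (R : realType) (q u v : R) : 0 <= q -> 0 <= u ->
  (forall e, 0 < e -> u <= expR (q * e) * v) -> u <= v.
Proof.
move=> q0 u0 H; apply/ler_addgt0Pr => e e0.
have c0 : 0 < u * q + 1 by rewrite ltr_wpDl // mulr_ge0.
have [h hE] : exists h, h = e / (u * q + 1) by exists (e / (u * q + 1)).
have h0 : 0 < h by rewrite hE divr_gt0.
have {}hE : h * (u * q + 1) = e by rewrite hE divfK // gt_eqF.
have := H h h0.
have e1 := expR_ge1Dx (- (q * h)).
rewrite -(ler_pM2l (expR_gt0 (- (q * h)))) mulrA -expRD addNr expR0 mul1r => uv.
have : u * (1 - q * h) <= expR (- (q * h)) * u by rewrite [leRHS]mulrC ler_wpM2l.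
have -> : u * (1 - q * h) = u - (e - h) by rewrite -hE; ring.
lra.
Qed.

Section Arrival.
Variables (R : realType) (Omega : Type) (S : nat -> Omega -> \bar R).
Hypothesis S_gt0 : forall n w, (0 < S n w)%E.
Implicit Types (n : nat) (t h u v : R) (w : Omega).

Definition arrived n t : set Omega := [set w | (jump_time S n w <= t%:E)%E].

Lemma jump_timeS n w : jump_time S n.+1 w = (jump_time S n w + S n w)%E.
Proof. by rewrite /jump_time big_ord_recr. Qed.

Lemma jump_time_ge0 n w : (0 <= jump_time S n w)%E.
Proof. by apply: sume_ge0 => i _; exact/ltW. Qed.

Lemma le_arrived n u v : u <= v -> arrived n u `<=` arrived n v.
Proof. by move=> uv w /= /le_trans; apply; rewrite lee_fin. Qed.

Lemma arrivedS n t : arrived n.+1 t `<=` arrived n t.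
Proof.
by move=> w; rewrite /arrived /= jump_timeS; apply: le_trans; rewrite leeDl // ltW.
Qed.

Lemma arrived0 t : 0 <= t -> arrived 0 t = setT.
Proof.
by move=> t0; apply/seteqP; split => // w _; rewrite /arrived /= /jump_time big_ord0 lee_fin.
Qed.

Lemma arrived_lt0 n t : t < 0 -> arrived n t = set0.
Proof.
move=> t0; apply/seteqP; split => // w /= /(le_trans (jump_time_ge0 n w)).
by rewrite lee_fin leNgt t0.
Qed.

Lemma arrivedS_0 n : arrived n.+1 0 = set0.
Proof.
apply/seteqP; split => // w; rewrite /arrived /= jump_timeS leNgt => /negP; apply.
by rewrite (lt_le_trans (S_gt0 n w)) // leeDr // jump_time_ge0.
Qed.

Lemma arrivedS_hold_le n u v w : arrived n u w -> (S n w <= v%:E)%E ->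
  arrived n.+1 (u + v) w.
Proof. by move=> nu nv; rewrite /arrived /= jump_timeS EFinD leeD. Qed.

Lemma arrivedS_hold_lt n u v w : arrived n.+1 (u + v) w -> (v%:E < S n w)%E ->
  arrived n u w.
Proof.
rewrite /arrived /= jump_timeS => le Sv; rewrite leNgt; apply/negP => ult.
by have := lt_le_trans (lteD ult Sv) le; rewrite EFinD ltxx.
Qed.

End Arrival.

Section JumpProcess.
Variables (R : realType) (V : eqType) (d : measure_display)
  (Omega : measurableType d) (P : probability Omega R).
Variables (Y : nat -> Omega -> V) (S : nat -> Omega -> \bar R).
Hypotheses (mY : forall n v, measurable [set w | Y n w = v])
  (mS : forall n, measurable_fun [set: Omega] (S n))
  (S_gt0 : forall n w, (0 < S n w)%E).
Implicit Types (A B C D : set Omega) (n m : nat) (t h : R).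

Definition pr A : R := fine (P A).

Lemma prE A : measurable A -> P A = (pr A)%:E.
Proof. by move=> mA; rewrite fineK ?fin_num_measure. Qed.

Lemma pr_ge0 A : 0 <= pr A.
Proof. by rewrite fine_ge0. Qed.

Lemma pr_set0 : pr set0 = 0.
Proof. by rewrite /pr measure0. Qed.

Lemma le_pr A B : measurable A -> measurable B -> A `<=` B -> pr A <= pr B.
Proof.
by move=> mA mB AB; rewrite -lee_fin -!prE // le_measure // inE.
Qed.

Lemma pr_le1 A : measurable A -> pr A <= 1.
Proof. by move=> mA; rewrite -lee_fin -prE // probability_le1. Qed.

Lemma prU A B : measurable A -> measurable B -> A `&` B = set0 ->
  pr (A `|` B) = pr A + pr B.
Proof.
move=> mA mB AB; apply: EFin_inj; rewrite EFinD -!prE ?measureU //.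
exact: measurableU.
Qed.

Lemma pr_split A B : measurable A -> measurable B ->
  pr A = pr (A `&` B) + pr (A `&` ~` B).
Proof.
move=> mA mB; rewrite -prU.
- by rewrite -setIUr setUCr setIT.
- exact: measurableI.
- by apply: measurableI => //; exact: measurableC.
- by rewrite setIACA setICr setI0.
Qed.

Definition held n (s : nat -> R) : set Omega :=
  [set w | forall i, (i < n)%N -> ((s i)%:E < S i w)%E].

Definition held_sets n : set (set Omega) :=
  [set A | exists s : nat -> R, (forall i, 0 <= s i) /\ A = held n s].

Lemma measurable_gtS i (s : R) : measurable [set w | (s%:E < S i w)%E].
Proof.
have := emeasurable_fun_o_infty measurableT (mS i) s%:E.
by rewrite setTI.
Qed.

Lemma measurable_held n (s : nat -> R) : measurable (held n s).
Proof.
have -> : held n s = \bigcap_(i < n) [set w | ((s i)%:E < S i w)%E] by [].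
by apply: bigcap_measurableType => i _; exact: measurable_gtS.
Qed.

Lemma held_setI_closed n : setI_closed (held_sets n).
Proof.
move=> _ _ [s [s0 ->]] [s' [s'0 ->]].
exists (fun i => Num.max (s i) (s' i)); split; first by move=> i; rewrite le_max s0.
apply/seteqP; split => [w [h h'] i ilt|w h].
  by rewrite EFin_max gt_max h // h'.
by split=> i ilt; have := h i ilt; rewrite EFin_max gt_max => /andP[].
Qed.

Lemma held_setT n : held_sets n [set: Omega].
Proof.
by exists (fun=> 0); split => //; apply/seteqP; split => // w _ i _; exact: S_gt0.
Qed.

(** The sigma-algebra of the first n holding times, generated by a pi-system on which the law
    of the process is prescribed. *)
Definition past n : set (set Omega) := <<s held_sets n >>.

Lemma past_measurable n C : past n C -> measurable C.
Proof.
apply: smallest_sub; first exact: sigma_algebra_measurable.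
by move=> _ [s [_ ->]]; exact: measurable_held.
Qed.

(** Two finite measures that agree on a pi-system agree on the sigma-algebra it generates. *)
Lemma past_unique n A B (c : R) : measurable A -> measurable B -> 0 <= c ->
  (forall s : nat -> R, (forall i, 0 <= s i) ->
    pr (A `&` held n s) = c * pr (B `&` held n s)) ->
  forall C, past n C -> pr (A `&` C) = c * pr (B `&` C).
Proof.
move=> mA mB c0 AB C pC; have mC := past_measurable pC.
have H : mrestr P mA C = mscale (NngNum c0) (mrestr P mB) C.
  apply: (@g_sigma_algebra_measure_unique _ R _ (held_sets n) _ (fun=> setT)) pC.
  - by move=> _ [s [_ ->]]; exact: measurable_held.
  - by move=> _; exact: held_setT.
  - by rewrite bigcup_const.
  - exact: held_setI_closed.
  - move=> _ [s [s0 ->]]; rewrite /mscale /= /mrestr ![held n s `&` _]setIC.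
    have mh D : measurable D -> measurable (D `&` held n s).
      by move=> mD; apply: measurableI => //; exact: measurable_held.
    rewrite prE ?AB ?EFinM -?prE //; try exact: mh.
    by rewrite [B `&` _]setIC.
  - by move=> _; rewrite /= /mrestr setTI ltey_eq fin_num_measure.
apply: EFin_inj; rewrite EFinM -!prE ?[_ `&` C]setIC //; exact: measurableI.
Qed.

Lemma past_jump_time n t : past n [set w | (jump_time S n w <= t%:E)%E].
Proof.
pose G := held_sets n.
have mSG (i : 'I_n) : measurable_fun [set: g_sigma_algebraType G] (S i).
  apply: (measurability _ (ErealGenOInfty.measurableE R)).
  move=> _ [_ [r ->] <-]; rewrite setTI preimage_itvoy.
  have [r0|r0] := ltP r 0.
    rewrite (_ : [set _ | _] = setT); first exact: measurableT.
    by apply/seteqP; split => // w _; apply: lt_trans (S_gt0 i w); rewrite lte_fin.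
  apply: sub_sigma_algebra; exists (fun j => if j == i :> nat then r else 0).
  split => [j|]; first by case: ifP.
  apply/seteqP; split => [w rw j jn|w]; first by case: eqP => [->|_].
  by move=> /(_ i (ltn_ord i)); rewrite eqxx.
have mT : measurable_fun [set: g_sigma_algebraType G] (jump_time S n).
  by apply: emeasurable_sum.
by have := emeasurable_fun_infty_c measurableT mT t%:E; rewrite setTI.
Qed.

Variables (x : V) (Jp : V -> V -> R) (q : V -> R).
Hypotheses (J_ge0 : forall y z, 0 <= Jp y z) (q_ge0 : forall y, 0 <= q y).
Hypothesis law : forall n (v : nat -> V) (s : nat -> R), (forall i, 0 <= s i) ->
  P [set w | forall i, (i <= n)%N -> Y i w = v i /\ ((s i)%:E < S i w)%E] =
  ((v 0%N == x)%:R * (\prod_(i < n) Jp (v i) (v i.+1))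
    * \prod_(i < n.+1) expR (- q (v i) * s i))%:E.
Implicit Types (r : seq V) (y z : V).

(** Paths are listed backwards, so that a further jump is a further head. *)
Fixpoint path_event r : set Omega :=
  if r is y :: r' then [set w | Y (size r') w = y] `&` path_event r' else setT.

Lemma measurable_path_event r : measurable (path_event r).
Proof.
elim: r => [|y r IHr] /=; first exact: measurableT.
by apply: measurableI.
Qed.

Lemma path_eventE r :
  path_event r = [set w | forall i, (i < size r)%N -> Y i w = nth x (rev r) i].
Proof.
elim: r => [|y r IHr] /=; first by apply/seteqP.
rewrite IHr rev_cons; apply/seteqP; split => w.
  move=> [Yy Yr] i; rewrite ltnS leq_eqVlt nth_rcons size_rev => /predU1P[->|ir].
    by rewrite ltnn eqxx.
  by rewrite ir Yr.
move=> H; split; first by rewrite /= H // nth_rcons size_rev ltnn eqxx.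
by move=> i ir; have := H i (ltnW ir); rewrite nth_rcons size_rev ir.
Qed.

Definition path_weight r : R := (nth x (rev r) 0 == x)%:R *
  \prod_(i < (size r).-1) Jp (nth x (rev r) i) (nth x (rev r) i.+1).

Definition path_decay r (s : nat -> R) : R :=
  \prod_(i < size r) expR (- q (nth x (rev r) i) * s i).

Lemma path_weight_cons y z r :
  path_weight [:: y, z & r] = path_weight (z :: r) * Jp z y.
Proof.
have nthr i : (i <= size r)%N -> nth x (rev [:: y, z & r]) i = nth x (rev (z :: r)) i.
  by move=> ir; rewrite rev_cons nth_rcons size_rev ltnS ir.
rewrite /path_weight nthr // [(size _).-1]/= big_ord_recr [(size (z :: r)).-1]/= mulrA.
congr (_ * _ * Jp _ _).
- by apply: eq_bigr => i _; rewrite /= !nthr ?(ltnW (ltn_ord i)) ?ltn_ord.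
- by rewrite nthr // rev_cons nth_rcons size_rev ltnn eqxx.
- by rewrite rev_cons nth_rcons size_rev ltnn eqxx.
Qed.

Lemma path_decay_cons y r s :
  path_decay (y :: r) s = path_decay r s * expR (- q y * s (size r)).
Proof.
rewrite /path_decay [size (y :: r)]/= big_ord_recr; congr (_ * _).
  by apply: eq_bigr => i _; rewrite /= rev_cons nth_rcons size_rev ltn_ord.
by rewrite rev_cons nth_rcons size_rev ltnn eqxx.
Qed.

Lemma path_decay_ext r s s' : (forall i, (i < size r)%N -> s i = s' i) ->
  path_decay r s = path_decay r s'.
Proof. by move=> ss; apply: eq_bigr => i _; rewrite ss. Qed.

Lemma pr_path_held y r (s : nat -> R) : (forall i, 0 <= s i) ->
  pr (path_event (y :: r) `&` held (size r).+1 s) =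
  path_weight (y :: r) * path_decay (y :: r) s.
Proof.
move=> s0; have := law (size r) (fun i => nth x (rev (y :: r)) i) s0.
rewrite /pr -/(path_weight (y :: r)) -/(path_decay (y :: r) s).
suff -> : path_event (y :: r) `&` held (size r).+1 s =
  [set w | forall i, (i <= size r)%N -> Y i w = nth x (rev (y :: r)) i /\
    ((s i)%:E < S i w)%E] by move=> ->.
rewrite path_eventE; apply/seteqP; split => [w [Yw Sw] i ir|w H].
  by split; [exact: Yw | exact: Sw].
by split => i ir; have [] := H i ir.
Qed.

Definition upd (s : nat -> R) n t i := if i == n then t else s i.

Lemma upd_ge0 s n t : (forall i, 0 <= s i) -> 0 <= t -> forall i, 0 <= upd s n t i.
Proof. by move=> s0 t0 i; rewrite /upd; case: ifP. Qed.

Lemma held_upd n s t :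
  held n s `&` [set w | (t%:E < S n w)%E] = held n.+1 (upd s n t).
Proof.
apply/seteqP; split => [w [H Hn] i|w H].
  rewrite ltnS leq_eqVlt /upd => /predU1P[->|ilt]; first by rewrite eqxx.
  by rewrite ltn_eqF // H.
split => [i ilt|]; last by have := H n (ltnSn n); rewrite /upd eqxx.
by have := H i (ltnW ilt); rewrite /upd ltn_eqF.
Qed.

Lemma held_upd0 n s : held n s = held n.+1 (upd s n 0).
Proof.
rewrite -held_upd; apply/seteqP; split => [w|w []//]; split => //; exact: S_gt0.
Qed.

(** Along a given path, the last holding time is exponential and independent of the
    previous ones. *)
Lemma pr_path_hold z r C t : past (size r) C -> 0 <= t ->
  pr (path_event (z :: r) `&` C `&` [set w | (t%:E < S (size r) w)%E]) =
  expR (- q z * t) * pr (path_event (z :: r) `&` C).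
Proof.
move=> pC t0; have mp := measurable_path_event (z :: r).
have mt := measurable_gtS (size r) t.
rewrite setIAC; apply: (past_unique _ mp _ _ pC).
- exact: measurableI.
- exact: expR_ge0.
move=> s s0; rewrite -setIA [_ `&` held _ _]setIC held_upd [in RHS]held_upd0.
rewrite !pr_path_held; try exact: upd_ge0.
rewrite !path_decay_cons (@path_decay_ext r _ (upd s (size r) 0)); last first.
  by move=> i ir; rewrite /upd ltn_eqF.
rewrite [upd s _ t _]/upd [upd s _ 0 (size r)]/upd eqxx mulr0 expR0 mulr1.
by rewrite mulrA mulrC.
Qed.

(** Along a given path, the next state is independent of the holding times. *)
Lemma pr_path_jump y z r C : past (size r).+1 C ->
  pr (path_event [:: y, z & r] `&` C) = Jp z y * pr (path_event (z :: r) `&` C).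
Proof.
move=> pC; apply: (past_unique _ _ _ _ pC) => //;
  [exact: measurable_path_event | exact: measurable_path_event |].
move=> s s0; rewrite [in LHS]held_upd0 !pr_path_held //; last exact: upd_ge0.
rewrite path_weight_cons path_decay_cons {2}/upd eqxx mulr0 expR0 mulr1.
rewrite -mulrA mulrCA; congr (_ * (_ * _)).
by apply: path_decay_ext => i ir; rewrite /upd ltn_eqF.
Qed.

Local Notation arrived := (arrived S).

Lemma past_arrived n t : past n (arrived n t).
Proof. exact: past_jump_time. Qed.

Lemma measurable_arrived n t : measurable (arrived n t).
Proof. exact: (past_measurable (@past_arrived n t)). Qed.

Lemma past_setIC n A B : past n A -> past n B -> past n (A `&` ~` B).
Proof.
move=> pA pB.
exact: (@measurableI _ (g_sigma_algebraType (held_sets n)) _ _ pA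
  (@measurableC _ (g_sigma_algebraType (held_sets n)) _ pB)).
Qed.

Let mp := measurable_path_event.
Let ma := measurable_arrived.
Let mI := @measurableI _ Omega.
Let mC := @measurableC _ Omega.

(** The entrance time of the last state is bounded by u and not by t, because the memoryless
    property is proved by cutting the entrance times into short strips. *)
Definition survive z r t h u : set Omega := path_event (z :: r) `&`
  arrived (size r) u `&` ~` arrived (size r).+1 (t + h).

Lemma measurable_survive z r t h u : measurable (survive z r t h u).
Proof. by apply: mI; [apply: mI; [exact: mp | exact: ma] | apply: mC; exact: ma]. Qed.

(** If the last state is entered between u and v, then it is left after t + h when its
    holding time exceeds t - u + h, and only when it exceeds t - v + h. *)
Lemma survive_strip z r t h u v : 0 <= h -> u <= v -> v <= t ->
  expR (- q z * (t - u + h)) * pr (path_event (z :: r) `&`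
     (arrived (size r) v `&` ~` arrived (size r) u)) <=
    pr (survive z r t h v) - pr (survive z r t h u) <=
  expR (- q z * (t - v + h)) * pr (path_event (z :: r) `&`
     (arrived (size r) v `&` ~` arrived (size r) u)).
Proof.
move=> h0 uv vt; set n := size r.
have vu : arrived n u `<=` arrived n v by exact: le_arrived.
have pc : past n (arrived n v `&` ~` arrived n u).
  by apply: past_setIC; exact: past_arrived.
have mc : measurable (arrived n v `&` ~` arrived n u) by exact: (past_measurable pc).
have mX := mI (mI (mp (z :: r)) mc) (mC (ma n.+1 (t + h))).
have -> : pr (survive z r t h v) - pr (survive z r t h u) =
    pr (path_event (z :: r) `&` (arrived n v `&` ~` arrived n u) `&`
      ~` arrived n.+1 (t + h)).
  rewrite (pr_split (measurable_survive z r t h v) (ma n u)) addrAC.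
  have -> : survive z r t h v `&` arrived n u = survive z r t h u.
    apply/seteqP; split => [w [[[pw _] nw] uw]|w [[pw uw] nw]]; first by split.
    by split=> //; split=> //; split=> //; exact: vu.
  rewrite subrr add0r; congr (pr _).
  apply/seteqP; split => [w [[[pw vw] nw] uw]|w [[pw [vw uw]] nw]].
    by split => //; split.
  by split => //; split => //; split.
have hS w : measurable [set w' | (w%:E < S n w')%E] by exact: measurable_gtS.
have h1 : 0 <= t - u + h by lra.
have h2 : 0 <= t - v + h by lra.
rewrite -(pr_path_hold z pc h1) -(pr_path_hold z pc h2) -/n; apply/andP; split.
  apply: le_pr => //; first exact: mI (mI (mp (z :: r)) mc) (hS _).
  move=> w [[pw [vw uw]] /= Sw]; split => //= aw; apply: uw.
  by apply: (@arrivedS_hold_lt _ _ S n u (t - u + h)) => //; rewrite addrA subrKC.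
apply: le_pr => //; first exact: mI (mI (mp (z :: r)) mc) (hS _).
move=> w [[pw [vw uw]] /= aw]; split => //=; rewrite ltNge; apply/negP => Sw.
apply: aw; have := arrivedS_hold_le vw Sw.
by rewrite addrA subrKC.
Qed.

(** The memoryless property at the deterministic time t. When the entrance times before t
    are cut into strips of length e, the two sides agree on each strip up to a factor
    expR (q z * e), by the previous lemma. *)
Lemma pr_survive z r t h : 0 <= t -> 0 <= h ->
  pr (survive z r t h t) = expR (- q z * h) * pr (survive z r t 0 t).
Proof.
move=> t0 h0; set k := - q z.
have key e : 0 < e ->
    pr (survive z r t h t) <= expR (q z * e) * (expR (k * h) * pr (survive z r t 0 t)) /\
    expR (k * h) * pr (survive z r t 0 t) <= expR (q z * e) * pr (survive z r t h t).
  (* Descend along the strips from u 0 = t until the entrance times become negative. *)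
  move=> e0; pose u (j : nat) := t - j%:R * e.
  suff H n m : t < (m + n)%:R * e ->
    pr (survive z r t h (u m)) <= expR (q z * e) * (expR (k * h) * pr (survive z r t 0 (u m))) /\
    expR (k * h) * pr (survive z r t 0 (u m)) <= expR (q z * e) * pr (survive z r t h (u m)).
    have := H (Num.truncn (t / e)).+1 0%N; rewrite /u mul0r subr0; apply.
    by rewrite add0n -ltr_pdivrMr // truncnS_gt.
  elim: n m => [m|n IHn m]; rewrite ?addn0 => tm.
    have em g : survive z r t g (u m) = set0.
      by rewrite /survive arrived_lt0 ?setI0 ?set0I // /u subr_lt0.
    by rewrite !em pr_set0 !mulr0.
  have {IHn}[i1 i2] := IHn m.+1 ltac:(by rewrite addSnnS).
  have uS : u m = u m.+1 + e by rewrite /u -[m.+1%:R]natr1; ring.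
  have le1 : u m.+1 <= u m by rewrite uS lerDl ltW.
  have le2 : u m <= t by rewrite /u gerBl mulr_ge0 // ltW.
  have /= := survive_strip z r h0 le1 le2.
  have /= := survive_strip z r (lexx 0) le1 le2.
  set p := pr _.
  have E0 w : expR (k * (t - w + 0)) = expR (k * (t - w)) by rewrite addr0.
  have Eh w : expR (k * (t - w + h)) = expR (k * (t - w)) * expR (k * h).
    by rewrite mulrDr expRD.
  rewrite -/k !E0 !Eh => /andP[a1 a2] /andP[b1 b2].
  have E : expR (k * (t - u m)) = expR (q z * e) * expR (k * (t - u m.+1)).
    by rewrite -expRD /k uS; congr expR; ring.
  have kh := expR_gt0 (k * h); have qe := expR_gt0 (q z * e).
  rewrite -(ler_pM2l kh) in a2; rewrite E in a2 b2.
  rewrite -(ler_pM2l (mulr_gt0 kh qe)) in a1.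
  rewrite -(ler_pM2l qe) in b1.
  split; lra.
apply/le_anti/andP; split.
  apply: (le_of_expR_factor (q_ge0 z)) (fun e e0 => (key e e0).1); exact: pr_ge0.
apply: (le_of_expR_factor (q_ge0 z)) (fun e e0 => (key e e0).2).
by rewrite mulr_ge0 ?expR_ge0 ?pr_ge0.
Qed.

Let mv := measurable_survive.

Definition occupation z r t : R := pr (survive z r t 0 t).

Lemma occupation_ge0 z r t : 0 <= occupation z r t.
Proof. exact: pr_ge0. Qed.

Lemma occupation_le1 z r t : occupation z r t <= 1.
Proof. exact: pr_le1 (mv _ _ _ _ _). Qed.

Lemma past_arrival n t h : past n (arrived n (t + h) `&` ~` arrived n t).
Proof. by apply: past_setIC; exact: past_arrived. Qed.

Let mar n t h : measurable (arrived n (t + h) `&` ~` arrived n t).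
Proof. by apply: mI; [exact: ma | apply: mC; exact: ma]. Qed.

Definition entry z r n t h : R :=
  pr (path_event (z :: r) `&` (arrived n (t + h) `&` ~` arrived n t)).

Let me z r n t h :
  measurable (path_event (z :: r) `&` (arrived n (t + h) `&` ~` arrived n t)).
Proof. by apply: mI; [exact: mp | exact: mar]. Qed.

Lemma entry_le1 z r n t h : entry z r n t h <= 1.
Proof. exact: pr_le1. Qed.

(** A state left between t and t + h was either entered before t, and then the memoryless
    property applies, or entered after t and held for a time at most h. *)
Lemma departure_bounds z r t h : 0 <= t -> 0 <= h ->
  (1 - expR (- q z * h)) * occupation z r t <= entry z r (size r).+1 t h <=
  (1 - expR (- q z * h)) * occupation z r t +
  (1 - expR (- q z * h)) * entry z r (size r) t h.
Proof.
move=> t0 h0; set n := size r; set X := path_event (z :: r).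
have part1 : pr (X `&` (arrived n.+1 (t + h) `&` ~` arrived n.+1 t) `&` arrived n t) =
    (1 - expR (- q z * h)) * occupation z r t.
  rewrite mulrBl mul1r -pr_survive //.
  rewrite [in RHS]/occupation (pr_split (mv z r t 0 t) (ma n.+1 (t + h))).
  have -> : survive z r t 0 t `&` ~` arrived n.+1 (t + h) = survive z r t h t.
    rewrite /survive addr0; apply/seteqP; split => [w [[[? ?] ?] ?]|w [[? ?] nw]].
      by split.
    by split=> //; split=> // aw; apply: nw; apply: le_arrived aw; rewrite lerDl.
  rewrite addrK; congr (pr _); rewrite /survive addr0.
  apply/seteqP; split => [w [[? [? ?]] ?]|w [[[? ?] ?] ?]].
    by split.
  by split=> //; split=> //; split.
have mX := me z r n.+1 t h.
rewrite /entry (pr_split mX (ma n t)) -/X part1.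
rewrite lerDl pr_ge0 lerD2l /=.
have mS' : measurable [set w | (h%:E < S n w)%E] by exact: measurable_gtS.
have mg := me z r n t h.
apply: (@le_trans _ _ (pr (X `&` (arrived n (t + h) `&` ~` arrived n t) `&`
    ~` [set w | (h%:E < S n w)%E]))).
  apply: le_pr => //.
  - by apply: mI => //; apply: mC; exact: ma.
  - by apply: mI => //; exact: mC.
  move=> w [[Xw [aw _]] nw]; split.
    by split=> //; split=> //; exact: arrivedS aw.
  by move=> Sw; apply: nw; exact: arrivedS_hold_lt aw Sw.
have := pr_split mg mS'; rewrite -/n (pr_path_hold z (@past_arrival n t h) h0) -/X -/n.
by move=> E; rewrite mulrBl mul1r {1}E addrAC subrr add0r.
Qed.

Lemma expR_decay_bounds (c h : R) : 0 <= c -> 0 <= h ->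
  0 <= 1 - expR (- c * h) <= c * h.
Proof.
move=> c0 h0; have := expR_ge1Dx (- c * h).
have : expR (- c * h) <= 1.
  by rewrite -[leRHS]expR0 ler_expR mulNr oppr_le0 mulr_ge0.
by move=> ? ?; apply/andP; split; lra.
Qed.

(** A state is entered when the previous one is left. *)
Lemma entry_linear z r : exists2 c, 0 <= c & forall t h, 0 <= t -> 0 <= h ->
  entry z r (size r) t h <= c * h.
Proof.
case: r => [|y r].
  exists 0 => // t h t0 h0; rewrite mul0r /entry /= !arrived0 ?addr_ge0 //.
  by rewrite setCT !setI0 pr_set0.
exists (2 * q y) => [|t h t0 h0]; first by rewrite mulr_ge0.
apply: (@le_trans _ _ (entry y r (size r).+1 t h)).
  apply: le_pr; [exact: me | exact: me |].
  by move=> w [[_ pw] aw]; split.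
have /andP[_ /le_trans] := departure_bounds y r t0 h0; apply.
have /andP[e0 e1] := expR_decay_bounds (q_ge0 y) h0.
have o1 := occupation_le1 y r t; have n1 := entry_le1 y r (size r) t h.
have : (1 - expR (- q y * h)) * occupation y r t <= (1 - expR (- q y * h)) * 1.
  exact: ler_wpM2l.
have : (1 - expR (- q y * h)) * entry y r (size r) t h <= (1 - expR (- q y * h)) * 1.
  exact: ler_wpM2l.
lra.
Qed.

(** A state occupied at time t + h was either already occupied at time t, or entered in
    between and not left, which has conditional probability at least expR (- q y * h). *)
Lemma occupation_step y z r t h : 0 <= t -> 0 <= h ->
  expR (- q y * h) * (Jp z y * entry z r (size r).+1 t h) <=
  occupation y (z :: r) (t + h) - expR (- q y * h) * occupation y (z :: r) t <=
  Jp z y * entry z r (size r).+1 t h.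
Proof.
move=> t0 h0; set n := (size r).+1; set X := path_event [:: y, z & r].
have mb := me y (z :: r) n t h.
have mA := ma n.+1 (t + h).
have -> : occupation y (z :: r) (t + h) - expR (- q y * h) * occupation y (z :: r) t =
    pr (X `&` (arrived n (t + h) `&` ~` arrived n t) `&` ~` arrived n.+1 (t + h)).
  rewrite -pr_survive //.
  rewrite /occupation (pr_split (mv y (z :: r) (t + h) 0 (t + h)) (ma n t)).
  have -> : survive y (z :: r) (t + h) 0 (t + h) `&` arrived n t =
      survive y (z :: r) t h t.
    rewrite /survive addr0; apply/seteqP; split => [w [[[? ?] ?] ?]|w [[? aw] ?]].
      by split.
    by split=> //; split=> //; split=> //; apply: le_arrived aw; rewrite lerDl.
  rewrite addrAC subrr add0r; congr (pr _); rewrite /survive addr0.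
  apply/seteqP; split => [w [[[? ?] ?] ?]|w [[? [? ?]] ?]].
    by split=> //; split.
  by split.
have mS' : measurable [set w | (h%:E < S n w)%E] by exact: measurable_gtS.
rewrite -(pr_path_jump y z (@past_arrival n t h)); apply/andP; split.
  rewrite -(pr_path_hold y (r := z :: r) (@past_arrival n t h) h0).
  apply: le_pr.
  - exact: mI.
  - by apply: mI => //; exact: mC.
  move=> w [[Xw [aw nw]] Sw]; split=> // an; apply: nw.
  exact: arrivedS_hold_lt an Sw.
by apply: le_pr; [apply: mI => //; exact: mC | exact: mb | move=> w []].
Qed.

(** Apart from the Taylor remainders of the exponentials, every error in
    [occupation_step] and [departure_bounds] is a product of two probabilities of order
    h. *)
Lemma occupation_forward y z r : qderiv (occupation y (z :: r))
  (fun t => - q y * occupation y (z :: r) t + q z * Jp z y * occupation z r t).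
Proof.
have [c c0 Hc] := entry_linear z r => T.
exists (expR (q y * `|T|) * q y ^+ 2 + Jp z y * (q y * (q z + q z)) +
  Jp z y * (q z * c) + Jp z y * (expR (q z * `|T|) * q z ^+ 2)) => t h t0 h0 thT.
have taylor v : 0 <= expR (- q v * h) - 1 + q v * h <= expR (q v * `|T|) * q v ^+ 2 * h ^+ 2.
  have := expR_sub1_sub_le (- q v * h).
  have -> : expR (- q v * h) - 1 - - q v * h = expR (- q v * h) - 1 + q v * h by ring.
  move=> /andP[-> /le_trans]; apply.
  have -> : (- q v * h) ^+ 2 = q v ^+ 2 * h ^+ 2 by ring.
  rewrite -mulrA ler_wpM2r ?mulr_ge0 ?sqr_ge0 // ler_expR normrM normrN.
  rewrite (ger0_norm (q_ge0 v)) (ger0_norm h0) ler_wpM2l //.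
  by apply: le_trans (ler_norm _); lra.
have := occupation_step y z r t0 h0; have := departure_bounds z r t0 h0.
set N := entry z r (size r).+1 t h; set g := entry z r (size r) t h.
set o := occupation z r t; set w := occupation y (z :: r) t.
have gc : g <= c * h by exact: Hc.
have [oc0 oc1] : 0 <= o /\ o <= 1 by split; [exact: occupation_ge0 | exact: occupation_le1].
have [w0 w1] : 0 <= w /\ w <= 1.
  by split; [exact: occupation_ge0 | exact: occupation_le1].
have g0 : 0 <= g by exact: pr_ge0.
have g1 : g <= 1 by exact: entry_le1.
have N0 : 0 <= N by exact: pr_ge0.
have /andP[e0 e1] := expR_decay_bounds (q_ge0 z) h0.
have /andP[f0 f1] := expR_decay_bounds (q_ge0 y) h0.
have /andP[ty0 ty1] := taylor y; have /andP[tz0 tz1] := taylor z.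
have qy := q_ge0 y; have qz := q_ge0 z; have J0 := J_ge0 z y.
move: e0 e1 f0 f1 ty0 ty1 tz0 tz1.
set ez := expR (- q z * h); set ey := expR (- q y * h).
set Ky := expR (q y * `|T|) * q y ^+ 2; set Kz := expR (q z * `|T|) * q z ^+ 2.
move: (occupation y (z :: r) (t + h)) => w2 e0 e1 f0 f1 ty0 ty1 tz0 tz1.
move=> /andP[N1 N2] /andP[b1 b2].
have Nle : N <= (q z + q z) * h.
  have : (1 - ez) * o <= 1 - ez by rewrite ler_piMr.
  have : (1 - ez) * g <= 1 - ez by rewrite ler_piMr.
  lra.
have Ky0 : 0 <= Ky by rewrite mulr_ge0 ?expR_ge0 ?sqr_ge0.
have Kz0 : 0 <= Kz by rewrite mulr_ge0 ?expR_ge0 ?sqr_ge0.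
have h20 : 0 <= h ^+ 2 by exact: sqr_ge0.
have p1 : (ey - 1 + q y * h) * w <= Ky * h ^+ 2.
  by apply: le_trans ty1; rewrite ler_piMr.
have p2 : 0 <= (ey - 1 + q y * h) * w by rewrite mulr_ge0.
have p3 : Jp z y * N <= Jp z y * ((1 - ez) * o + (1 - ez) * g) by rewrite ler_wpM2l.
have p4 : Jp z y * ((1 - ez) * g) <= Jp z y * (q z * c) * h ^+ 2.
  rewrite -mulrA ler_wpM2l //.
  have -> : q z * c * h ^+ 2 = q z * h * (c * h) by ring.
  exact: ler_pM.
have p5 : Jp z y * ((1 - ez) * o) <= Jp z y * (q z * h * o).
  by rewrite ler_wpM2l // ler_wpM2r.
have p6 : Jp z y * ((1 - ez) * o) <= Jp z y * N by rewrite ler_wpM2l.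
have p7 : Jp z y * (q z * h * o) - Jp z y * ((1 - ez) * o) <= Jp z y * Kz * h ^+ 2.
  rewrite -mulrBr -[leRHS]mulrA ler_wpM2l // -mulrBl.
  by apply: (@le_trans _ _ ((q z * h - (1 - ez)) * 1)); rewrite ?ler_wpM2l //; lra.
have p8 : (1 - ey) * (Jp z y * N) <= Jp z y * (q y * (q z + q z)) * h ^+ 2.
  have -> : Jp z y * (q y * (q z + q z)) * h ^+ 2 =
    q y * h * (Jp z y * ((q z + q z) * h)) by ring.
  by apply: ler_pM => //; rewrite ?mulr_ge0 // ler_wpM2l.
have q1 : 0 <= Ky * h ^+ 2 by rewrite mulr_ge0.
have q2 : 0 <= Jp z y * Kz * h ^+ 2 by rewrite !mulr_ge0.
have q3 : 0 <= Jp z y * (q z * c) * h ^+ 2 by rewrite !mulr_ge0.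
have q4 : 0 <= Jp z y * (q y * (q z + q z)) * h ^+ 2 by rewrite !mulr_ge0 ?addr_ge0.
by rewrite ler_norml; apply/andP; split; lra.
Qed.

End JumpProcess.

Section WordSums.
Variables (R : realType) (V : eqType).
Implicit Types (F G : seq V) (n : nat) (r : seq V).

Fixpoint words F n : seq (seq V) :=
  if n is m.+1 then [seq z :: r | z <- F, r <- words F m] else [:: [::]].

Lemma sum_words0 F (g : seq V -> R) : \sum_(r <- words F 0) g r = g [::].
Proof. by rewrite big_seq1. Qed.

Lemma sum_wordsS F n (g : seq V -> R) :
  \sum_(r <- words F n.+1) g r = \sum_(z <- F) \sum_(r <- words F n) g (z :: r).
Proof. by rewrite big_allpairs_dep. Qed.

Lemma size_words F n r : r \in words F n -> size r = n.
Proof.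
by elim: n r => [|n IHn] r /=; [rewrite inE => /eqP-> |
  case/allpairsP => -[z r'] /= [_ /IHn <- ->]].
Qed.

Lemma ler_sum_subset F G (g : V -> R) : uniq F -> uniq G -> {subset G <= F} ->
  (forall z, 0 <= g z) -> \sum_(z <- G) g z <= \sum_(z <- F) g z.
Proof.
move=> uF uG GF g0; rewrite [leRHS](bigID (mem G)) /= -[X in _ <= X + _]big_filter.
have pe : perm_eq [seq z <- F | z \in G] G.
  apply: uniq_perm => [||z]; rewrite ?filter_uniq // mem_filter andb_idr //.
  exact: GF.
by rewrite (perm_big _ pe) lerDl sumr_ge0.
Qed.

Lemma ler_sum_words F G n (g : seq V -> R) : uniq F -> uniq G -> {subset G <= F} ->
  (forall r, 0 <= g r) -> \sum_(r <- words G n) g r <= \sum_(r <- words F n) g r.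
Proof.
move=> uF uG GF; elim: n g => [|n IHn] g g0; first by rewrite !sum_words0.
rewrite !sum_wordsS; apply: (@le_trans _ _ (\sum_(z <- G) \sum_(r <- words F n) g (z :: r))).
  by apply: ler_sum => z _; apply: IHn.
by apply: ler_sum_subset => // z; apply: sumr_ge0.
Qed.

End WordSums.

Section PathKernel.
Variables (R : realType) (V : eqType) (d : measure_display)
  (Omega : measurableType d) (P : V -> probability Omega R).
Variables (Y : nat -> Omega -> V) (S : nat -> Omega -> \bar R).
Hypotheses (mY : forall n v, measurable [set w | Y n w = v])
  (mS : forall n, measurable_fun [set: Omega] (S n))
  (S_gt0 : forall n w, (0 < S n w)%E).
Variables (Jp : V -> V -> R) (q : V -> R).
Hypotheses (J_ge0 : forall y z, 0 <= Jp y z) (q_ge0 : forall y, 0 <= q y).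
Hypothesis law : forall x n (v : nat -> V) (s : nat -> R), (forall i, 0 <= s i) ->
  P x [set w | forall i, (i <= n)%N -> Y i w = v i /\ ((s i)%:E < S i w)%E] =
  ((v 0%N == x)%:R * (\prod_(i < n) Jp (v i) (v i.+1))
    * \prod_(i < n.+1) expR (- q (v i) * s i))%:E.
Implicit Types (A B C D : set Omega) (n m : nat) (t h : R) (r : seq V) (x y z : V)
  (F G : seq V).

Local Notation arrived := (arrived S).
Local Notation path_event := (path_event Y).

Let mp := measurable_path_event mY.
Let ma := measurable_arrived mS S_gt0.

Definition path_kernel F n t x y : R :=
  \sum_(r <- words F n) occupation (P x) Y S y r t.

Lemma pr_start x y : pr (P x) (path_event [:: y]) = (y == x)%:R.
Proof.
have := pr_path_held (@law x) y [::] (fun=> lexx 0).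
rewrite /path_weight /path_decay /= !big_ord_recl !big_ord0 !mulr1 mulr0 expR0 mulr1 => <-.
congr (pr _ _); apply/seteqP; split => [w pw|w []//]; split=> // i _.
Qed.

Lemma occupation_nil x y t : 0 <= t ->
  occupation (P x) Y S y [::] t = (x == y)%:R * expR (- q y * t).
Proof.
move=> t0; have := pr_path_held (@law x) y [::] (fun=> t0).
rewrite /path_weight /path_decay !big_ord_recl !big_ord0 /= !mulr1 [y == x]eq_sym => <-.
rewrite /occupation /survive addr0 arrived0 // setIT; congr (pr _ _).
apply/seteqP; split => w [pw H]; split=> //; move: H; rewrite /arrived /= /jump_time big_ord1.
  by move=> /negP; rewrite -ltNge => H [].
by move=> /(_ 0%N isT); rewrite leNgt => ->.
Qed.

(** The forward equation holds path by path, and a path of n + 1 jumps to y is a path of n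
    jumps followed by a jump to y. *)
Lemma path_kernel_graded F :
  graded_kernel F q (fun z y => q z * Jp z y) (path_kernel F).
Proof.
split.
- by move=> n t x y _; apply: sumr_ge0 => r _; exact: occupation_ge0.
- by move=> t x y t0; rewrite /path_kernel sum_words0 occupation_nil.
- move=> n x y; rewrite /path_kernel big1_seq // => r /andP[_ /size_words sr].
  by rewrite /occupation /survive sr arrivedS_0 // setI0 set0I pr_set0.
move=> n x y.
have := qderiv_sum F (fun z => qderiv_sum (words F n) (fun r =>
  occupation_forward mY mS S_gt0 J_ge0 q_ge0 (@law x) y z r)).
apply: qderiv_ext => t t0; first by rewrite /path_kernel sum_wordsS.
rewrite /path_kernel sum_wordsS mulr_sumr -big_split; apply: eq_bigr => z _ /=.
by rewrite big_split /= -!mulr_sumr; congr (_ + _); rewrite mulrC.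
Qed.

Lemma sum_pr_states_le x F n B : uniq F -> measurable B ->
  \sum_(z <- F) pr (P x) ([set w | Y n w = z] `&` B) <= pr (P x) B.
Proof.
elim: F B => [|z F IHF] B /=; first by rewrite big_nil pr_ge0.
move=> /andP[zF uF] mB; rewrite big_cons [leRHS](pr_split (P x) mB (mY n z)).
rewrite [_ `&` B]setIC lerD2l.
apply: le_trans (IHF _ uF _); last first.
  by apply: measurableI => //; exact: measurableC.
rewrite !big_seq; apply: ler_sum => y yF; rewrite le_eqVlt; apply/orP; left; apply/eqP.
congr (pr _ _); apply/seteqP; split => [w [Yy Bw]|w [Yy [Bw _]]] //.
split=> //; split=> //= Yz; move: zF; rewrite -Yz Yy yF //.
Qed.

Lemma sum_pr_path_le x F n B : uniq F -> measurable B ->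
  \sum_(r <- words F n) pr (P x) (path_event r `&` B) <= pr (P x) B.
Proof.
move=> uF; elim: n B => [|n IHn] B mB; first by rewrite sum_words0 /= setTI.
rewrite sum_wordsS; apply: le_trans (sum_pr_states_le x n uF mB).
apply: ler_sum => z _; apply: le_trans (IHn _ _); last exact: measurableI.
rewrite !big_seq; apply: ler_sum => r /size_words sr.
by rewrite /= sr -setIA setICA.
Qed.

(** Almost surely, the first n states of the chain started from x lie in F. *)
Definition exhausting x F n := 1 <= \sum_(r <- words F n) pr (P x) (path_event r).

(** Apply [sum_pr_path_le] to the complement of B. *)
Lemma exhausting_ge x F n B : uniq F -> exhausting x F n -> measurable B ->
  pr (P x) B <= \sum_(r <- words F n) pr (P x) (path_event r `&` B).
Proof.
move=> uF ex mB; have := sum_pr_path_le x n uF (measurableC mB).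
have := pr_split (P x) measurableT mB; rewrite !setTI.
have -> : pr (P x) setT = 1 by rewrite /pr probability_setT.
have : \sum_(r <- words F n) pr (P x) (path_event r) =
    \sum_(r <- words F n) pr (P x) (path_event r `&` B) +
    \sum_(r <- words F n) pr (P x) (path_event r `&` ~` B).
  by rewrite -big_split; apply: eq_bigr => r _; exact: pr_split.
by move: ex; rewrite /exhausting; lra.
Qed.

Hypothesis J_total : forall z, exists L : seq V, forall F, uniq F -> {subset L <= F} ->
  1 <= \sum_(y <- F) Jp z y.

Lemma J_total_seq G : exists L : seq V, forall z F, z \in G -> uniq F ->
  {subset L <= F} -> 1 <= \sum_(y <- F) Jp z y.
Proof.
elim: G => [|z G [L HL]]; first by exists [::].
have [L' HL'] := J_total z; exists (L' ++ L) => y F.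
rewrite inE => /predU1P[-> uF sub|yG uF sub].
  by apply: HL' => // u uL; rewrite sub // mem_cat uL.
by apply: HL => // u uL; rewrite sub // mem_cat uL orbT.
Qed.

(** By local finiteness, the chain reaches only finitely many states in n jumps. *)
Lemma exhausting_exists x n : exists L : seq V, forall F, uniq F ->
  {subset L <= F} -> exhausting x F n.
Proof.
case: n => [|n].
  exists [::] => F _ _; rewrite /exhausting sum_words0 /=.
  by rewrite /pr probability_setT.
elim: n => [|n [L HL]].
  exists [:: x] => F uF xF; rewrite /exhausting sum_wordsS.
  under eq_bigr do rewrite sum_words0 pr_start -[_%:R]mul1r.
  by rewrite (sum_seq_eq (fun=> 1) uF) // xF // mem_head.
have [L' HL'] := J_total_seq (undup L).
exists (L ++ L') => F uF sub; rewrite /exhausting sum_wordsS exchange_big /=.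
have uL := undup_uniq L.
have subL : {subset undup L <= F}.
  by move=> u; rewrite mem_undup => uL'; rewrite sub // mem_cat uL'.
have ge0 r : 0 <= \sum_(y <- F) pr (P x) (path_event (y :: r)).
  by apply: sumr_ge0 => y _; exact: pr_ge0.
apply: le_trans (ler_sum_words n.+1 uF uL subL ge0).
apply: (@le_trans _ _ (\sum_(r <- words (undup L) n.+1) pr (P x) (path_event r))).
  by apply: HL => // u; rewrite mem_undup.
rewrite !sum_wordsS !big_seq; apply: ler_sum => z zL; apply: ler_sum => r _.
have E y : pr (P x) (path_event [:: y, z & r]) = Jp z y * pr (P x) (path_event (z :: r)).
  have pT : past S (size r).+1 setT by apply: sub_sigma_algebra; exact: held_setT.
  by have := pr_path_jump mY mS S_gt0 J_ge0 (@law x) y z pT; rewrite !setIT.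
under eq_bigr do rewrite E.
rewrite -mulr_suml ler_peMl ?pr_ge0 //; apply: HL' zL uF _ => u uL'.
by rewrite sub // mem_cat uL' orbT.
Qed.

Variable X : R -> Omega -> option V.
Hypothesis XE : forall t w y, 0 <= t ->
  X t w = Some y <->
  exists n, Y n w = y /\ (jump_time S n w <= t%:E < jump_time S n.+1 w)%E.

Definition stays n t y : set Omega :=
  [set w | Y n w = y] `&` (arrived n t `&` ~` arrived n.+1 t).

Lemma measurable_stays n t y : measurable (stays n t y).
Proof.
by apply: measurableI => //; apply: measurableI; [exact: ma | apply: measurableC; exact: ma].
Qed.

Lemma trivIset_stays t y : trivIset setT (fun n => stays n t y).
Proof.
have H m n w : (m < n)%N -> stays m t y w -> stays n t y w -> False.
  move=> mn [_ [_ nm]] [_ [an _]]; apply: nm; move: mn an.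
  elim: n => // n IHn; rewrite ltnS leq_eqVlt => /predU1P[-> //|mn] an.
  by apply: IHn => //; exact: (arrivedS S_gt0).
move=> m n _ _ [w [sm sn]]; case: (ltngtP m n) => // mn; first by have := H _ _ _ mn sm sn.
by have := H _ _ _ mn sn sm.
Qed.

Lemma at_stateE t y : 0 <= t -> [set w | X t w = Some y] = \bigcup_n stays n t y.
Proof.
move=> t0; apply/seteqP; split => [w /= /XE -/(_ t0) [n [Yn /andP[an nn]]]|w [n _ [Yn [an nn]]]].
  by exists n => //; split=> //; split=> //; apply/negP; rewrite -ltNge.
apply/XE => //; exists n; split=> //; apply/andP; split=> //.
by rewrite ltNge; apply/negP.
Qed.

Lemma occupation_stays x y r t :
  occupation (P x) Y S y r t = pr (P x) (path_event r `&` stays (size r) t y).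
Proof.
rewrite /occupation /survive /stays addr0; congr (pr _ _).
by rewrite /= [path_event r `&` _]setICA !setIA.
Qed.

Lemma path_kernel_le_stays F n t x y : uniq F ->
  path_kernel F n t x y <= pr (P x) (stays n t y).
Proof.
move=> uF; apply: le_trans (sum_pr_path_le x n uF (measurable_stays n t y)).
rewrite /path_kernel !big_seq; apply: ler_sum => r /size_words sr.
by rewrite occupation_stays sr.
Qed.

Lemma at_state_series x t y : 0 <= t ->
  P x [set w | X t w = Some y] = (\sum_(n <oo) (pr (P x) (stays n t y))%:E)%E.
Proof.
move=> t0; have mst n := measurable_stays n t y.
rewrite at_stateE // measure_semi_bigcup //.
- by apply: eq_eseriesr => n _; exact: prE.
- exact: trivIset_stays.
- exact: bigcupT_measurable.
Qed.

Lemma trunc_path_kernel_le F N t x y : uniq F -> 0 <= t ->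
  ((trunc_kernel (path_kernel F) N t x y)%:E <= P x [set w | X t w = Some y])%E.
Proof.
move=> uF t0; rewrite at_state_series //.
apply: le_trans (nneseries_lim_ge N _); last by move=> n _ _; rewrite lee_fin pr_ge0.
rewrite sumEFin lee_fin big_mkord; apply: ler_sum => n _; exact: path_kernel_le_stays.
Qed.

(** The process is at y only after finitely many jumps, since it is killed at explosion;
    the states visited during these jumps almost surely lie in a finite list. *)
Lemma at_state_le x t y (L0 : seq V) (M : R) : 0 <= t ->
  (forall F N, uniq F -> {subset L0 <= F} -> trunc_kernel (path_kernel F) N t x y <= M) ->
  (P x [set w | X t w = Some y] <= M%:E)%E.
Proof.
move=> t0 H; rewrite at_state_series //; apply: lime_le.
  by apply: is_cvg_nneseries => n _ _; rewrite lee_fin pr_ge0.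
apply: nearW => N /=; rewrite sumEFin lee_fin big_mkord.
have [L HL] : exists L : seq V, forall F n, (n < N)%N -> uniq F -> {subset L <= F} ->
    exhausting x F n.
  elim: N => [|N [L HL]]; first by exists [::].
  have [L' HL'] := exhausting_exists x N; exists (L ++ L') => F n.
  rewrite ltnS leq_eqVlt => /predU1P[-> uF sub|nN uF sub].
    by apply: HL' => // u uL; rewrite sub // mem_cat uL orbT.
  by apply: HL => // u uL; rewrite sub // mem_cat uL.
have uF := undup_uniq (L0 ++ L).
apply: le_trans (H _ N uF _); last by move=> u uL; rewrite mem_undup mem_cat uL.
apply: ler_sum => n _.
have ex : exhausting x (undup (L0 ++ L)) n.
  by apply: HL => // u uL; rewrite mem_undup mem_cat uL orbT.
apply: le_trans (exhausting_ge uF ex (measurable_stays n t y)) _.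
rewrite /path_kernel !big_seq; apply: ler_sum => r /size_words sr.
by rewrite occupation_stays sr.
Qed.

End PathKernel.

(** * The generator of a weighted graph *)

Section GraphGenerator.
Variables (R : realType) (V : metricType R) (E : rel V) (mu : V -> V -> R) (nu : V -> R).
Hypotheses (graphE : connected_locally_finite_graph E) (edge_mu : edge_weight E mu)
  (nu_gt0 : forall x, 0 < nu x) (metE : adapted_metric E mu nu).
Implicit Types (x y z : V) (F L : seq V).

Let Q := qmatrix (generator mu nu).
Let Jp := jump_prob (generator mu nu).

Definition exit_rate x : R := - Q x x.
(** Loops of the graph do not contribute to the generator. *)
Definition off_rate x y : R := if x == y then 0 else mu x y / nu x.

Lemma mu_ge0 x y : 0 <= mu x y.
Proof.
case: edge_mu => _ mu_gt0 mu0; case: (boolP (E x y)) => [/mu_gt0/ltW //|/mu0 ->//].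
Qed.

Lemma off_rate_ge0 x y : 0 <= off_rate x y.
Proof. by rewrite /off_rate; case: eqP => // _; rewrite divr_ge0 ?mu_ge0 ?ltW. Qed.

Lemma off_rate_sym x y : nu x * off_rate x y = nu y * off_rate y x.
Proof.
rewrite /off_rate [y == x]eq_sym; case: eqP => _; first by rewrite !mulr0.
by case: edge_mu => mus _ _; rewrite [mu y x]mus; field; rewrite !gt_eqF.
Qed.

Lemma neighbourhood x : exists L, forall F, uniq F -> {subset L <= F} ->
  forall g : V -> R, \sum_(y \in [set: V]) g y * mu x y = \sum_(y <- F) g y * mu x y.
Proof.
case: graphE => _ _ /(_ x) /finite_seqP[L HL]; exists L => F uF LF g.
rewrite (fsbigE F) //; first by apply: eq_bigl => y; rewrite in_setT.
move=> y _ yF; case: edge_mu => _ _ mu0; rewrite mu0 ?mulr0 //.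
apply/negP => Exy; move: yF; rewrite LF //.
by have : [set y | E x y] y by []; rewrite HL.
Qed.

Lemma qmatrix_off x y : x != y -> Q x y = mu x y / nu x.
Proof.
move=> xy; rewrite /Q /qmatrix /generator.
have [L HL] := neighbourhood x; pose F := undup (y :: L).
have uF : uniq F by exact: undup_uniq.
rewrite (HL F) => // [|z zL]; last by rewrite mem_undup inE zL orbT.
rewrite (negPf xy) mulrC; congr (_ / _).
have yF : y \in F by rewrite mem_undup mem_head.
rewrite -[RHS](sum_seq_eq (mu x) uF yF); apply: eq_bigr => z _.
by rewrite subr0 mulrC.
Qed.

Lemma exit_rateE x : exists L, forall F, uniq F -> {subset L <= F} ->
  exit_rate x = \sum_(y <- F) off_rate x y.
Proof.
have [L HL] := neighbourhood x; exists L => F uF LF.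
rewrite /exit_rate /Q /qmatrix /generator (HL F) // -mulrN -sumrN mulr_sumr.
apply: eq_bigr => y _; rewrite eqxx /off_rate [y == x]eq_sym; case: eqP => _.
  by rewrite subrr mul0r oppr0 mulr0.
by rewrite sub0r mulN1r opprK mulrC.
Qed.

Lemma sum_off_rate_le x F : uniq F -> \sum_(y <- F) off_rate x y <= exit_rate x.
Proof.
move=> uF; have [L HL] := exit_rateE x.
rewrite (HL (undup (F ++ L))) ?undup_uniq //.
  apply: ler_sum_subset => //; [exact: undup_uniq | | exact: off_rate_ge0].
  by move=> y yF; rewrite mem_undup mem_cat yF.
by move=> y yL; rewrite mem_undup mem_cat yL orbT.
Qed.

Lemma exit_rate_ge0 x : 0 <= exit_rate x.
Proof. by have := sum_off_rate_le x (F := [::]) isT; rewrite big_nil. Qed.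

Lemma jump_probE x y : Jp x y =
  if exit_rate x == 0 then (x == y)%:R else off_rate x y / exit_rate x.
Proof.
rewrite /Jp /jump_prob -/Q /exit_rate oppr_eq0; case: ifP => // _.
by rewrite /off_rate; case: eqVneq => [_|xy]; rewrite ?mul0r // qmatrix_off.
Qed.

Lemma jump_prob_ge0 x y : 0 <= Jp x y.
Proof.
rewrite jump_probE; case: ifP => _; first exact: ler0n.
by rewrite divr_ge0 ?off_rate_ge0 ?exit_rate_ge0.
Qed.

(** In an absorbing state both sides vanish, whatever the convention for the jump chain. *)
Lemma exit_rate_jump x y : exit_rate x * Jp x y = off_rate x y.
Proof.
rewrite jump_probE; case: ifP => [/eqP q0|/negbT q0]; last by rewrite mulrC divfK.
rewrite q0 mul0r; apply/eqP; rewrite eq_le off_rate_ge0 /= -q0.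
by have := sum_off_rate_le x (F := [:: y]) isT; rewrite big_seq1.
Qed.

Lemma jump_prob_total x : exists L, forall F, uniq F -> {subset L <= F} ->
  1 <= \sum_(y <- F) Jp x y.
Proof.
have [L HL] := exit_rateE x; exists (x :: L) => F uF sub.
have E1 : exit_rate x = \sum_(y <- F) off_rate x y.
  by apply: HL => // y yL; rewrite sub // inE yL orbT.
have [q0|q0] := eqVneq (exit_rate x) 0; last first.
  under eq_bigr do rewrite jump_probE (negPf q0).
  by rewrite -mulr_suml -E1 divff.
under eq_bigr do rewrite jump_probE q0 eqxx eq_sym -[_%:R]mul1r.
by rewrite (sum_seq_eq (fun=> 1) uF) // sub // mem_head.
Qed.

Lemma off_rate_adapted x F : uniq F ->
  \sum_(y <- F) off_rate x y * mdist x y ^+ 2 <= 1.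
Proof.
move=> uF; have [L HL] := neighbourhood x; have [/(_ x) adapted _] := metE; move: adapted.
pose G := undup (F ++ L).
have uG : uniq G by exact: undup_uniq.
rewrite (HL G) // => [H|y yL]; last by rewrite mem_undup mem_cat yL orbT.
apply: le_trans H; rewrite mulr_sumr.
apply: (@le_trans _ _ (\sum_(y <- G) off_rate x y * mdist x y ^+ 2)).
  apply: ler_sum_subset => // [y yF|y]; first by rewrite mem_undup mem_cat yF.
  by rewrite mulr_ge0 ?sqr_ge0 ?off_rate_ge0.
apply: ler_sum => y _; rewrite /off_rate; case: eqP => _.
  by rewrite mul0r mulr_ge0 ?invr_ge0 ?(ltW (nu_gt0 x)) // mulr_ge0 ?sqr_ge0 ?mu_ge0.
by rewrite [mu x y / _]mulrC -mulrA [mu x y * _]mulrC.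
Qed.

Lemma off_rate_short x y : 1 < mdist x y -> off_rate x y = 0.
Proof.
case: metE edge_mu => _ d1 [_ _ mu0] dxy; rewrite /off_rate; case: ifP => // _.
rewrite mu0 ?mul0r //; apply/negP => /d1; by rewrite leNgt dxy.
Qed.

End GraphGenerator.

(** * The Gaussian upper bound *)

(* In \bar R the inverse of 0 is +oo, so (f t)%:E^-1 is 1 / f t with 1 / 0 = +oo. *)
Theorem theorem1p1 (R : realType) :
  exists C1 theta : R, [/\ 0 < C1, 0 < theta &
    forall (V : metricType R) (E : rel V) (mu : V -> V -> R) (nu : V -> R)
      (d : measure_display) (Omega : measurableType d)
      (P : V -> probability Omega R) (X : R -> Omega -> option V),
    connected_locally_finite_graph E ->
    edge_weight E mu ->
    (forall x, 0 < nu x) ->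
    minimal_ctmc (generator mu nu) P X ->
    adapted_metric E mu nu ->
    forall (A gamma delta : R) (x1 x2 : V) (f1 f2 : R -> R),
    1 <= A -> 1 < gamma -> 1 <= delta ->
    (forall t, 0 <= t ->
      (P x1 [set w | X t w = Some x1] <= (f1 t)%:E^-1)%E) ->
    (forall t, 0 <= t ->
      (P x2 [set w | X t w = Some x2] <= (f2 t)%:E^-1)%E) ->
    regular_fun A gamma f1 -> regular_fun A gamma f2 ->
    (forall t, 0 <= t -> f1 t <= A * expR (delta * t)) ->
    (forall t, 0 <= t -> f2 t <= A * expR (delta * t)) ->
    let alpha := Num.min (2 * gamma)^-1 (64 * delta)^-1 in
    let beta : int := Num.ceil (ln 2 / ln gamma) in
    forall t, 0 < t -> mdist x1 x2 <= t ->
    (P x1 [set w | X t w = Some x2] <=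
      (C1 * A ^ beta * Num.sqrt (nu x2 / nu x1)
        / Num.sqrt (f1 (alpha * t) * f2 (alpha * t))
        * expR (- theta * (mdist x1 x2 ^+ 2 / t)))%:E)%E].
Proof.
exists (2 * (4 * 5 * 5 * 5 + 2)), (4^-1 / 4 / 4 / 5 / 5 / 10).
split; [lra | by rewrite !divr_gt0 | ].
move=> V E mu nu d Omega P X graphE edge_mu nu_gt0 [Y [S [[mY mS] S_gt0 law0 XE]]] metE.
move=> A gamma delta x1 x2 f1 f2 A1 g1 d1 P1 P2 rf1 rf2 fe1 fe2 alpha beta t t0 dt.
have [b [bE b0 b2 bg]] := ceil_log2 g1.
pose q := exit_rate mu nu; pose Jp := jump_prob (generator mu nu).
pose rate z y := q z * Jp z y.
have q_ge0 := exit_rate_ge0 graphE edge_mu nu_gt0.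
have J_ge0 := jump_prob_ge0 graphE edge_mu nu_gt0.
have J_total := jump_prob_total nu graphE edge_mu.
have OE := exit_rate_jump graphE edge_mu nu_gt0.
have rate_ge0 x y : 0 <= rate x y by rewrite mulr_ge0.
have rate_sym x y : nu x * rate x y = nu y * rate y x.
  by rewrite /rate !OE; exact: (off_rate_sym edge_mu nu_gt0).
have rate_short x y : 1 < mdist x y -> rate x y = 0.
  by move=> dxy; rewrite /rate OE; exact: (off_rate_short edge_mu metE).
have law x n (v : nat -> V) (s : nat -> R) : (forall i, 0 <= s i) ->
    P x [set w | forall i, (i <= n)%N -> Y i w = v i /\ ((s i)%:E < S i w)%E] =
    ((v 0%N == x)%:R * (\prod_(i < n) Jp (v i) (v i.+1))
      * \prod_(i < n.+1) expR (- q (v i) * s i))%:E.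
  move=> s0; rewrite law0 //; congr (_ * _)%:E; apply: eq_bigr => i _.
  by rewrite /q /exit_rate opprK.
have al0 : 0 < alpha by rewrite /alpha lt_min !invr_gt0 !mulr_gt0 //; lra.
have al1 : alpha <= (2 * gamma)^-1 by rewrite /alpha ge_min lexx.
have al2 : alpha <= (64 * delta)^-1 by rewrite /alpha ge_min lexx orbT.
have at0 : 0 < alpha * t by rewrite mulr_gt0.
have al_le1 : alpha <= 1.
  by apply: le_trans al1 _; rewrite invf_le1 ?mulr_gt0 //; lra.
have att : alpha * t <= t by rewrite ler_piMl // ltW.
have f1p := regular_fun_gt0 rf1; have f2p := regular_fun_gt0 rf2.
have Ab1 : 1 <= A ^+ b by rewrite exprn_ege1.
set r := mdist x1 x2 / 2.
have r0 : 0 <= r by rewrite divr_ge0 ?mdist_ge0.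
have rt : r <= t / 2 by rewrite ler_pM2r.
pose K : R := (4 * 5 * 5 * 5 + 2) * A ^+ b.
have K1 : 1 <= K by rewrite /K; lra.
pose e := expR (- (r ^+ 2 / (t / 2) / 4 / 4 / 5 / 5 / 10)).
have e0 : 0 < e by exact: expR_gt0.
apply: (at_state_le mY mS S_gt0 J_ge0 law J_total XE (L0 := [:: x1; x2])).
  exact: ltW.
move=> F N uF sub.
have x1F : x1 \in F by rewrite sub // mem_head.
have x2F : x2 \in F by rewrite sub // !inE eqxx orbT.
have ka := path_kernel_graded mY mS S_gt0 J_ge0 q_ge0 law F.
set a := path_kernel _ _ _ _ in ka *.
have rate_adapted y : \sum_(z <- F) rate y z * mdist y z ^+ 2 <= 1.
  under eq_bigr do rewrite /rate OE.
  exact: (off_rate_adapted graphE edge_mu nu_gt0 metE).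
have rate_total y : \sum_(z <- F) rate y z <= q y.
  by under eq_bigr do rewrite /rate OE; exact: (sum_off_rate_le graphE edge_mu nu_gt0).
have total x f : x \in F -> (forall t, 0 < t -> 0 < f t) ->
    (forall s, 0 <= s -> (P x [set w | X s w = Some x] <= (f s)%:E^-1)%E) ->
    forall M s, 0 < s -> nu x * total_energy F a nu M x s <= (f (2 * s))^-1.
  move=> xF fp Pf M s s0; have s20 : 0 < 2 * s by rewrite mulr_gt0.
  apply: le_trans (total_energy_le uF ka nu_gt0 rate_sym M (ltW s0) xF) _.
  rewrite -lee_fin; apply: (@le_trans _ _ (P x [set w | X (2 * s) w = Some x])).
    apply: (trunc_path_kernel_le P mY mS S_gt0 XE) => //; exact: ltW.
  by apply: le_trans (Pf _ (ltW s20)) _; rewrite inver gt_eqF // fp.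
have far x f : x \in F -> (forall t, 0 < t -> 0 < f t) -> regular_fun A gamma f ->
    (forall s, 0 <= s -> f s <= A * expR (delta * s)) ->
    (forall s, 0 <= s -> (P x [set w | X s w = Some x] <= (f s)%:E^-1)%E) ->
    nu x * far_energy F a nu N.+1 x r (t / 2) <= K * e * (f (alpha * t))^-1.
  move=> xF fp rf fe Pf.
  have eb := far_energy_bounds uF rate_ge0 ka nu_gt0 rate_sym rate_adapted rate_total
    rate_short N xF.
  have := far_energy_gaussian eb (total x f xF fp Pf N.+1) A1 g1 d1 rf fe b0 b2 bg
    al0 al1 al2 t0 r0 rt.
  by move/le_trans; apply; rewrite /K /e le_eqVlt; apply/orP; left; apply/eqP; ring.
have tot x f : x \in F -> regular_fun A gamma f ->
    (forall s, 0 <= s -> (P x [set w | X s w = Some x] <= (f s)%:E^-1)%E) ->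
    nu x * total_energy F a nu N.+1 x (t / 2) <= (f (alpha * t))^-1.
  move=> xF rf Pf; have fp := regular_fun_gt0 rf.
  apply: le_trans (total x f xF fp Pf N.+1 _ _) _; first by rewrite divr_gt0.
  rewrite mulrCA divff ?mulr1 // lef_pV2 ?posrE ?fp //.
  by apply: (regular_fun_le rf) => //; exact: ltW.
(* The initial condition of the energy bounds needs at least one term in the kernel. *)
have mono : trunc_kernel a N t x1 x2 <= trunc_kernel a N.+1 t x1 x2.
  by rewrite /trunc_kernel big_ord_recr lerDl (gk_ge0 ka) // ltW.
apply: le_trans mono _.
have Ke : 0 < K * e by rewrite mulr_gt0 //; lra.
apply: le_trans (off_diagonal_le uF ka nu_gt0 rate_sym x1F x2F t0 _ _ _ Ke
  (far x1 f1 x1F f1p rf1 fe1 P1) (tot x1 f1 x1F rf1 P1)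
  (far x2 f2 x2F f2p rf2 fe2 P2) (tot x2 f2 x2F rf2 P2)) _.
- by rewrite /r mulrCA divff ?mulr1.
- by rewrite invr_gt0 f1p.
- by rewrite invr_gt0 f2p.
have -> : A ^ beta = A ^+ b by rewrite /beta bE.
have K0 : 0 <= K by apply: le_trans K1.
have sK : Num.sqrt K <= K.
  have s1 : 1 <= Num.sqrt K by rewrite -[leLHS]sqrtr1 ler_sqrt.
  by rewrite -{2}(sqr_sqrtr K0) expr2 ler_peMl // (le_trans ler01).
(* The radius is half of the distance and the time is t / 2, so that r^2 / (t / 2) is half
   of the square of the distance over t; the square root halves it once more. *)
have se : Num.sqrt e = expR (- (4^-1 / 4 / 4 / 5 / 5 / 10) * (mdist x1 x2 ^+ 2 / t)).
  set c := expR _; suff -> : e = c ^+ 2 by rewrite sqrtr_sqr ger0_norm ?expR_ge0.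
  rewrite /e /c -expRM_natl /r; congr expR; field.
  by rewrite gt_eqF.
rewrite -invfM sqrtrV; last by rewrite mulr_ge0 // ltW ?f1p ?f2p.
rewrite (sqrtrM e K0) se; set c := expR _; set s := Num.sqrt (nu x2 / nu x1).
set v := (Num.sqrt _)^-1.
have -> : 2 * (4 * 5 * 5 * 5 + 2) * A ^+ b * s * v * c = 2 * s * v * (K * c).
  by rewrite /K; ring.
rewrite ler_wpM2l ?ler_wpM2r ?expR_ge0 // !mulr_ge0 ?invr_ge0 ?sqrtr_ge0 //.
Qed.
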